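(* Let $(M,g)$ be a smooth $n$-dimensional Riemannian manifold, let $A>0$ be a real constant and let $v:(0,\infty)\to\mathbb{R}$ be a smooth function with $A+2v(t)>0$ for all $t>0$. Let $G$ and $J$ be the Riemannian metric and the almost complex structure on the nonzero cotangent bundle $T^*_0M$ determined by $A$ and $v$ as described in the context. Then $(T^*_0M,G,J)$ is an almost Kähler manifold.
   Context: Everything is of class $C^\infty$; indices run over $1,\dots,n$ and repeated indices are summed. $\pi:T^*M\to M$ is the cotangent bundle and $T^*_0M$ is $T^*M$ minus the zero section. A local chart $(U,x^1,\dots,x^n)$ on $M$ induces the chart $(\pi^{-1}(U),q^1,\dots,q^n,p_1,\dots,p_n)$ on $T^*M$, where $q^i=x^i\circ\pi$ and $p=p_i\,dx^i_{\pi(p)}$. Let $g_{ij}$ be the components of $g$, $(g^{ij})$ the inverse matrix, $\Gamma^k_{ij}$ the Christoffel symbols of the Levi-Civita connection $\dot\nabla$ of $g$, $g^{0i}=p_hg^{hi}$, $\Gamma^0_{ij}=p_k\Gamma^k_{ij}$. Set $$\frac{\delta}{\delta q^i}=\frac{\partial}{\partial q^i}+\Gamma^0_{ih}\frac{\partial}{\partial p_h},\qquad Dp_i=dp_i-\Gamma^0_{ij}dq^j ;$$ the fields $\frac{\delta}{\delta q^i},\frac{\partial}{\partial p_i}$ form a local frame (adapted to the splitting of $TT^*M$ into horizontal and vertical distributions), with dual coframe $dq^i,Dp_i$. Let $t=\frac12\|p\|^2=\frac12 g^{ik}p_ip_k$. Define $$G_{ij}=At\,g_{ij}+v(t)p_ip_j,$$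 and let $(H^{kl})$ be the inverse of the matrix $(G_{ij})$, i.e. $H^{kl}=\frac{1}{At}g^{kl}+w(t)g^{0k}g^{0l}$ with $w=\frac{-v}{At^2(A+2v)}$. (The matrix $(G_{ij})$ is positive definite if and only if $A>0$ and $A+2v>0$.) The Riemannian metric is $G=G_{ij}dq^idq^j+H^{ij}Dp_iDp_j$, that is $$G\Big(\frac{\delta}{\delta q^i},\frac{\delta}{\delta q^j}\Big)=G_{ij},\quad G\Big(\frac{\partial}{\partial p_i},\frac{\partial}{\partial p_j}\Big)=H^{ij},\quad G\Big(\frac{\partial}{\partial p_i},\frac{\delta}{\delta q^j}\Big)=0 .$$ The almost complex structure is given by $$J\frac{\delta}{\delta q^i}=G_{ik}\frac{\partial}{\partial p_k},\qquad J\frac{\partial}{\partial p_i}=-H^{ik}\frac{\delta}{\delta q^k}.$$ Almost Kähler means: $J$ is an almost complex structure, $G(JX,JY)=G(X,Y)$ for all vector fields $X,Y$, and the fundamental 2-form $\phi(X,Y)=G(X,JY)$ is closed. *)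

(* Defs.v *)
(* MathComp world, with MathComp-Analysis. *)
From mathcomp Require Import all_boot all_order all_algebra.
From mathcomp Require Import all_classical all_reals all_analysis.

Set Implicit Arguments.
Unset Strict Implicit.
Unset Printing Implicit Defensive.

Import Order.TTheory GRing.Theory Num.Theory.
Import numFieldNormedType.Exports.

Local Open Scope classical_set_scope.
Local Open Scope ring_scope.

Definition partial (R : realType) (m : nat) (a : 'I_m) (f : 'rV[R]_m -> R) :
  'rV[R]_m -> R := fun u => 'D_(delta_mx 0 a) f u.

Fixpoint Ck_on (R : realType) (m k : nat) (D : set 'rV[R]_m)
    (f : 'rV[R]_m -> R) : Prop :=
  if k is k'.+1 then
    (forall u, D u -> differentiable f u) /\
    (forall a : 'I_m, Ck_on k' D (partial a f))
  else forall u, D u -> {for u, continuous f}.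

(* Meant for open [D] only: the derivatives are unrestricted ones. *)
Definition smooth_on (R : realType) (m : nat) (D : set 'rV[R]_m)
  (f : 'rV[R]_m -> R) : Prop := forall k, Ck_on k D f.

(* [v : R -> R] is only looked at on the open half-line. *)
Definition smooth_on_pos (R : realType) (v : R -> R) : Prop :=
  forall (k : nat) (t : R), 0 < t -> derivable (derive1n k v) t 1.

(* A set with an atlas; the manifold topology is the one induced by the charts.
   [coord i] is only meaningful on [dom i]. *)
Record atlas (R : realType) (m : nat) := Atlas {
  carrier :> Type;
  chart : Type;
  dom : chart -> set carrier;
  coord : chart -> carrier -> 'rV[R]_m
}.

Section Manifold.
Variables (R : realType) (m : nat) (N : atlas R m).

Definition image_in (i : chart N) (S : set N) : set 'rV[R]_m :=
  coord i @` (dom i `&` S).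

(* f \o (coord i)^-1, extended by 0 outside the image of the chart. *)
Definition read (V : zmodType) (i : chart N) (f : N -> V) (u : 'rV[R]_m) : V :=
  if pselect (exists2 x : N, dom i x & coord i x = u) is left e
  then f (s2val (cid2 e)) else 0.

Definition smooth_in (i : chart N) (f : N -> R) : Prop :=
  smooth_on (image_in i setT) (read i f).

Definition open_set (S : set N) : Prop := forall i, open (image_in i S).

Definition smooth_manifold : Prop :=
  [/\ (forall i : chart N, {in dom i &, injective (coord i)}),
      (forall i j : chart N, open (image_in i (dom j))) /\
      (forall (i j : chart N) (a : 'I_m),
         smooth_on (image_in i (dom j)) (fun u => read i (coord j) u 0 a)),
      (forall x y : N, x <> y ->
         exists S T : set N,
           [/\ open_set S, open_set T, S x, T y & S `&` T = set0]) &
      (* second countability, and the fact that the charts cover *)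
      (exists C : set (chart N),
         countable C /\ forall x : N, exists2 i, C i & dom i x)].

(* Entry (a, b) is the partial derivative of the b-th coordinate of chart [j]
   with respect to the a-th coordinate of chart [i]. *)
Definition jac (i j : chart N) (x : N) : 'M[R]_m :=
  jacobian (read i (coord j)) (coord i x).

(* Tensor fields are given by their components in every chart; the values at
   points outside the chart are irrelevant. Components of vectors are row
   vectors, and an endomorphism acts on them by right multiplication: row a of
   its matrix lists the components of the image of the a-th basis vector. *)
Definition vec_comp := chart N -> N -> 'rV[R]_m.
Definition mx_comp := chart N -> N -> 'M[R]_m.

Definition is_vector_field (X : vec_comp) : Prop :=
  (forall i a, smooth_in i (fun x => X i x 0 a)) /\
  (forall i j x, dom i x -> dom j x -> X j x = X i x *m jac i j x).

Definition is_bilinear_field (B : mx_comp) : Prop :=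
  (forall i a b, smooth_in i (fun x => B i x a b)) /\
  (forall i j x, dom i x -> dom j x ->
     B i x = jac i j x *m B j x *m (jac i j x)^T).

Definition is_endomorphism_field (J : mx_comp) : Prop :=
  (forall i a b, smooth_in i (fun x => J i x a b)) /\
  (forall i j x, dom i x -> dom j x ->
     J i x *m jac i j x = jac i j x *m J j x).

Definition beval (B : 'M[R]_m) (X Y : 'rV[R]_m) : R := (X *m B *m Y^T) 0 0.

Definition riemannian_metric (G : mx_comp) : Prop :=
  [/\ is_bilinear_field G,
      (forall i x, dom i x -> (G i x)^T = G i x) &
      (forall i x, dom i x -> forall X : 'rV[R]_m, X != 0 ->
         0 < beval (G i x) X X)].

Definition almost_complex_structure (J : mx_comp) : Prop :=
  is_endomorphism_field J /\
  (forall i x, dom i x -> J i x *m J i x = - 1%:M).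

Definition hermitian (G J : mx_comp) : Prop :=
  forall X Y : vec_comp, is_vector_field X -> is_vector_field Y ->
  forall i x, dom i x ->
    beval (G i x) (X i x *m J i x) (Y i x *m J i x) =
    beval (G i x) (X i x) (Y i x).

(* phi(X, Y) = G(X, JY). *)
Definition fundamental_form (G J : mx_comp) : mx_comp :=
  fun i x => G i x *m (J i x)^T.

Definition partial_at (i : chart N) (a : 'I_m) (f : N -> R) (x : N) : R :=
  partial a (read i f) (coord i x).

Definition is_2form (w : mx_comp) : Prop :=
  is_bilinear_field w /\ (forall i x, dom i x -> (w i x)^T = - w i x).

(* Components (dw)_{abc} for skew-symmetric [w]. *)
Definition ext_deriv (w : mx_comp) (i : chart N) (x : N) (a b c : 'I_m) : R :=
  partial_at i a (fun y => w i y b c) x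
  + partial_at i b (fun y => w i y c a) x
  + partial_at i c (fun y => w i y a b) x.

Definition closed_2form (w : mx_comp) : Prop :=
  is_2form w /\
  (forall i x, dom i x -> forall a b c, ext_deriv w i x a b c = 0).

Definition almost_kahler_manifold (G J : mx_comp) : Prop :=
  smooth_manifold /\
  [/\ riemannian_metric G, almost_complex_structure J, hermitian G J &
      closed_2form (fundamental_form G J)].

(* Gamma^k_{ab} of the Levi-Civita connection of [g]. *)
Definition christoffel (g : mx_comp) (i : chart N) (x : N) (k a b : 'I_m) : R :=
  2^-1 * \sum_(h < m) invmx (g i x) k h *
    (partial_at i a (fun y => g i y h b) x
     + partial_at i b (fun y => g i y a h) x
     - partial_at i h (fun y => g i y a b) x).

(* A nonzero covector at [base]: its components in every chart around [base],
   and 0 by convention in the other charts. *)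
Record cotangent0 := Cotangent0 {
  base : N;
  covec : chart N -> 'rV[R]_m;
  _ : forall i j, dom i base -> dom j base ->
        covec i = covec j *m (jac i j base)^T;
  _ : forall i, ~ dom i base -> covec i = 0;
  _ : exists i, covec i <> 0
}.

(* The induced charts (q, p), in this order. *)
Definition cotangent0_atlas : atlas R (m + m) :=
  @Atlas R (m + m) cotangent0 (chart N)
    (fun i => [set z | dom i (base z)])
    (fun i z => row_mx (coord i (base z)) (covec z i)).

End Manifold.

Section Lift.
Variables (R : realType) (n : nat) (M : atlas R n) (g : mx_comp M).
Variables (A : R) (v : R -> R).
Variables (i : chart M) (z : cotangent0 M).

Let gz : 'M[R]_n := g i (base z).
Let p : 'rV[R]_n := covec z i.

Definition energy : R := 2^-1 * (p *m invmx gz *m p^T) 0 0.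

Definition Gamma0 : 'M[R]_n :=
  \matrix_(a, b) \sum_(k < n) p 0 k * christoffel g i (base z) k a b.

Definition Gmx : 'M[R]_n := (A * energy) *: gz + v energy *: (p^T *m p).
Definition Hmx : 'M[R]_n := invmx Gmx.

(* Rows: components of the fields delta/delta q^i, then d/dp_i. *)
Definition frame : 'M[R]_(n + n) := block_mx 1%:M Gamma0 0 1%:M.
(* Columns: components of the forms dq^i, then Dp_i. *)
Definition coframe : 'M[R]_(n + n) := block_mx 1%:M (- Gamma0^T) 0 1%:M.

Definition lift_metric_at : 'M[R]_(n + n) :=
  coframe *m block_mx Gmx 0 0 Hmx *m coframe^T.

Definition lift_J_at : 'M[R]_(n + n) :=
  coframe *m block_mx 0 Gmx (- Hmx) 0 *m frame.

End Lift.

Definition lift_metric (R : realType) (n : nat) (M : atlas R n) (g : mx_comp M)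
  (A : R) (v : R -> R) : mx_comp (cotangent0_atlas M) :=
  fun i z => lift_metric_at g A v i z.

Definition lift_J (R : realType) (n : nat) (M : atlas R n) (g : mx_comp M)
  (A : R) (v : R -> R) : mx_comp (cotangent0_atlas M) :=
  fun i z => lift_J_at g A v i z.

(* Main.v *)
(* In the induced chart the fundamental form is the constant form with blocks
   (0, -1; 1, 0), i.e. the canonical symplectic form up to sign: in the adapted
   frame it pairs G with its inverse H, and the terms produced by the change of
   frame cancel because Gamma^0 is symmetric. Hence it is closed. Positivity of
   G_ij follows from Cauchy-Schwarz. The transformation laws of G and J come from
   the one of the adapted coframe, which is the transformation law of the
   Christoffel symbols contracted with p; the latter rests on the chain rule and
   on the symmetry of second derivatives. *)

From HB Require Import structures.
Require Import Defs.
From mathcomp Require Import all_boot all_order all_algebra.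
From mathcomp Require Import all_classical all_reals all_analysis.
From mathcomp Require Import ring lra.
Import Order.TTheory GRing.Theory Num.Theory.
Import numFieldNormedType.Exports.
(* [vector.coord] would otherwise hide the field [coord] of an atlas. *)
Import Defs.

Set Implicit Arguments.
Unset Strict Implicit.
Unset Printing Implicit Defensive.

Local Open Scope classical_set_scope.
Local Open Scope ring_scope.

(** * Smooth functions of several variables *)

(** Two choices of encoding shape the argument. Smoothness speaks of iterated partial derivatives,
    and a function read in a chart is extended by 0 outside the image of that chart; a formula for
    it is therefore known only on an open set, and derivatives are computed through local equality
    there. With row vectors, the change of induced charts has Jacobian [block_mx J B 0 K^T], where J
    is the Jacobian of the change of base charts, K its inverse, and B is linear in p and in the
    derivatives of K. Differentiating J K = 1 turns B J^T into minus the contraction of p with the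
    second derivatives of the new coordinates. This is the inhomogeneous term of the Christoffel law
    with the opposite sign, so the adapted coframe changes by the block-diagonal matrix of J and
    K^T, and the laws of the lifted tensors reduce to block algebra. The conclusion also contains
    that the nonzero cotangent bundle is a manifold, so its atlas needs explicit images, transition
    maps and separation. *)

Section Differentiation.
Context {R : realType}.

(** The difference [g - f] vanishes near [x], so its expansion at [x] has zero linear part and it is
    differentiable there; adding it to [f] gives [g]. *)
Lemma near_eq_differentiable (V W : normedModType R) (f g : V -> W) (x : V) :
  {near x, f =1 g} -> differentiable f x -> differentiable g x.
Proof.
move=> fg df.
pose h := g - f.
have h0 : \forall y \near x, h y = 0.
  by near=> y; rewrite /h fctE; rewrite -(near fg y) ?subrr.
have hx : h x = 0 by exact: nbhs_singleton h0.
have hs : h \o shift x = cst (h x) + (0 : V -> W) +o_ 0 id.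
  apply/eqaddoP => e e0; move/nbhs0P: h0; apply: filterS => y hy.
  rewrite hx /=; have -> : (h \o shift x - (cst 0 + 0)) y = 0.
    by rewrite -[LHS]/(h (y + x) - (0 + 0)) addrC addr0 [y + x]addrC hy oppr0 addr0.
  rewrite normr0.
  by apply: mulr_ge0; [exact: ltW|exact: normr_ge0].
have dh : differentiable h x.
  have c0 : continuous (0 : V -> W) by exact: cst_continuous.
  apply/diff_locallyP.
  have -> : 'd h x = \0 :> (V -> W).
    exact: (@diff_unique _ _ _ _ (\0%R : {linear V -> W})).
  by [].
rewrite (_ : g = f + h); last by rewrite /h addrC subrK.
exact: differentiableD.
Unshelve. all: by end_near. Qed.

Lemma open_near_eq (T : topologicalType) (U : Type) (D : set T) (f g : T -> U) x :
  open D -> D x -> (forall y, D y -> f y = g y) -> {near x, f =1 g}.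
Proof.
by move=> oD Dx fg; apply: filterS (open_nbhs_nbhs (conj oD Dx)) => y /fg.
Qed.

Lemma partial_near m (a : 'I_m) (f g : 'rV[R]_m -> R) u :
  {near u, f =1 g} -> partial a f u = partial a g u.
Proof. by move=> fg; apply: near_eq_derive. Qed.

Lemma partialE m (a : 'I_m) (f : 'rV[R]_m -> R) u : differentiable f u ->
  partial a f u = 'd f u (delta_mx 0 a).
Proof. exact: deriveE. Qed.

Lemma differentiable_rowP m l (F : 'rV[R]_m -> 'rV[R]_l) u :
  (forall b, differentiable (fun w => F w 0 b : R) u) -> differentiable F u.
Proof.
move=> dF.
rewrite (_ : F = \sum_(b < l) (fun w => (F w 0 b : R) *: delta_mx 0 b)).
  by apply: differentiable_sum => b; apply: differentiableZl.
by apply/funext => w; rewrite fct_sumE -row_sum_delta.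
Qed.

Lemma jacobianE m l (F : 'rV[R]_m -> 'rV[R]_l) u a b : differentiable F u ->
  jacobian F u a b = partial a (fun w => F w 0 b) u.
Proof.
move=> dF; have -> : jacobian F u a b = (row a (jacobian F u)) 0 b by rewrite [RHS]mxE.
rewrite rowE -deriveEjacobian // derive_mx ?mxE //.
exact: diff_derivable.
Qed.

Lemma partial_comp m l (F : 'rV[R]_m -> 'rV[R]_l) (f : 'rV[R]_l -> R) u a :
  differentiable F u -> differentiable f (F u) ->
  partial a (f \o F) u = \sum_(b < l) jacobian F u a b * partial b f (F u).
Proof.
move=> dF df; rewrite partialE; last exact: differentiable_comp.
rewrite diff_comp //= -(deriveE _ dF) deriveEjacobian // -rowE.
rewrite [row a _]row_sum_delta linear_sum; apply: eq_bigr => b _.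
by rewrite linearZ partialE // mxE.
Qed.

Lemma partialD m (a : 'I_m) (f g : 'rV[R]_m -> R) u :
  differentiable f u -> differentiable g u ->
  partial a (fun w => f w + g w) u = partial a f u + partial a g u.
Proof. by move=> df dg; apply: deriveD; exact: diff_derivable. Qed.

Lemma partialM m (a : 'I_m) (f g : 'rV[R]_m -> R) u :
  differentiable f u -> differentiable g u ->
  partial a (fun w => f w * g w) u = partial a f u * g u + f u * partial a g u.
Proof.
move=> df dg; rewrite /partial (@deriveM _ _ f g); try exact: diff_derivable.
by rewrite addrC ![_ *: _]mulrC [f u * _]mulrC.
Qed.

Lemma partial_cst m (a : 'I_m) (c : R) u : partial a (fun _ : 'rV[R]_m => c) u = 0.
Proof. exact: derive_cst. Qed.

Lemma partial_coord m (a b : 'I_m) u :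
  partial a (fun w : 'rV[R]_m => w 0 b) u = (b == a)%:R.
Proof.
have [did _] := differentiableP (@differentiable_coord R 1 m u 0 b).
have id : differentiable (id : 'rV[R]_m -> _) u by exact: ex_diff.
rewrite -jacobianE // /jacobian mxE diff_val.
by rewrite mxE eqxx.
Qed.

Lemma differentiable_fsum (V W : normedModType R) (I : Type) (r : seq I)
  (P : pred I) (f : I -> V -> W) x : (forall i, P i -> differentiable (f i) x) ->
  differentiable (fun w => \sum_(i <- r | P i) f i w) x.
Proof.
move=> df; rewrite -fct_sumE; elim/big_ind : _ => //.
by move=> *; apply: differentiableD.
Qed.

Lemma partial_sum m (I : Type) (r : seq I) (a : 'I_m) (f : I -> 'rV[R]_m -> R) u :
  (forall i, differentiable (f i) u) ->
  partial a (fun w => \sum_(i <- r) f i w) u = \sum_(i <- r) partial a (f i) u.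
Proof.
move=> df; elim: r => [|i r IH].
  under eq_fun do rewrite big_nil; rewrite big_nil; exact: partial_cst.
under eq_fun do rewrite big_cons; rewrite big_cons partialD ?IH //.
exact: differentiable_fsum.
Qed.

End Differentiation.

(** * Closure properties of smooth functions *)

Section Smoothness.
Context {R : realType} {m : nat}.
Implicit Types (D : set 'rV[R]_m) (f g : 'rV[R]_m -> R).

Lemma Ck_on_eq k D f g : open D -> (forall u, D u -> f u = g u) ->
  Ck_on k D f -> Ck_on k D g.
Proof.
move=> oD; elim: k f g => [|k IH] f g fg /=.
  move=> cf u Du; have nfg := open_near_eq oD Du fg.
  rewrite /prop_for /continuous_at -(fg _ Du).
  exact: cvg_trans (near_eq_cvg nfg) (cf _ Du).
move=> [df cf]; split => [u Du|a].
  exact: near_eq_differentiable (open_near_eq oD Du fg) (df _ Du).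
by apply: IH (cf a) => u Du; apply: partial_near; apply: open_near_eq oD Du fg.
Qed.

(** [Ck_on] constrains [partial a f] as a global function, while the usual rules of calculus compute
    it only on [D]. This rule accepts a formula valid on [D] and drives the inductions on [k]
    below. *)
Lemma Ck_onS_intro k D f : open D -> (forall u, D u -> differentiable f u) ->
  (forall a, exists2 g, (forall u, D u -> g u = partial a f u) & Ck_on k D g) ->
  Ck_on k.+1 D f.
Proof.
move=> oD df H; split=> // a; have [g gf cg] := H a.
exact: Ck_on_eq cg.
Qed.

Lemma Ck_onW k D f : Ck_on k.+1 D f -> Ck_on k D f.
Proof.
elim: k f => [|k IH] f [df cf].
  by move=> u /df /differentiable_continuous.
by split=> // a; apply: IH.
Qed.

Lemma Ck_on_cst k D c : Ck_on k D (fun _ => c).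
Proof.
elim: k c => [|k IH] c /=; first by move=> u _; apply: cst_continuous.
split=> [u _|a]; first exact: differentiable_cst.
by rewrite (_ : partial a _ = fun _ => 0) //; apply/funext => u; rewrite partial_cst.
Qed.

Lemma Ck_on_coord k D a : Ck_on k D (fun u => u 0 a).
Proof.
case: k => [|k] /=; first by move=> u _; apply: coord_continuous.
split=> [u _|b]; first exact: differentiable_coord.
rewrite (_ : partial b _ = fun _ => (a == b)%:R); first exact: Ck_on_cst.
by apply/funext => u; rewrite partial_coord.
Qed.

Lemma Ck_onD k D f g : open D -> Ck_on k D f -> Ck_on k D g ->
  Ck_on k D (fun u => f u + g u).
Proof.
move=> oD; elim: k f g => [|k IH] f g /=.
  by move=> cf cg u Du; apply: continuousD; [exact: cf|exact: cg].
move=> [df cf] [dg cg]; apply: Ck_onS_intro => // [u Du|a].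
  by apply: differentiableD; [exact: df|exact: dg].
exists (fun u => partial a f u + partial a g u); last exact: IH.
by move=> u Du; rewrite partialD //; [exact: df|exact: dg].
Qed.

Lemma Ck_onM k D f g : open D -> Ck_on k D f -> Ck_on k D g ->
  Ck_on k D (fun u => f u * g u).
Proof.
move=> oD; elim: k f g => [|k IH] f g.
  by move=> cf cg u Du; apply: continuousM; [exact: cf|exact: cg].
move=> cf1 cg1; have [[df cf] [dg cg]] := (cf1, cg1).
apply: Ck_onS_intro => // [u Du|a].
  by apply: differentiableM; [exact: df|exact: dg].
exists (fun u => partial a f u * g u + f u * partial a g u).
  by move=> u Du; rewrite partialM //; [exact: df|exact: dg].
(* Each Leibniz term pairs a derivative, of class [k], with an undifferentiated factor of class
   [k.+1], which is lowered to class [k] before the induction hypothesis applies. *)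
by apply: Ck_onD => //; [exact: IH (cf a) (Ck_onW cg1)|exact: IH (Ck_onW cf1) (cg a)].
Qed.

Lemma Ck_onV k D f : open D -> (forall u, D u -> f u != 0) ->
  Ck_on k D f -> Ck_on k D (fun u => (f u)^-1).
Proof.
move=> oD f0; elim: k => [|k IH].
  by move=> cf u Du; apply: continuousV; [exact: f0|exact: cf].
move=> cf1; have [df cf] := cf1; have IH' := IH (Ck_onW cf1).
apply: Ck_onS_intro => // [u Du|a].
  by apply: differentiableV; [exact: df|exact: f0].
(* The square of the inverse is used rather than the inverse of the square: the induction hypothesis
   already covers the inverse of [f], and products then suffice. *)
exists (fun u => (-1) * ((f u)^-1 * (f u)^-1) * partial a f u).
  move=> u Du; rewrite /partial [RHS]deriveV; first last.
    exact/diff_derivable/df.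
    exact: f0.
  by rewrite -[_ *: _]/(_ * _) expr2 invfM mulN1r.
apply: Ck_onM => //; [apply: Ck_onM => //; [exact: Ck_on_cst|exact: Ck_onM]|exact: cf].
Qed.

Lemma differentiable_comp1 (w : R -> R) f u : derivable w (f u) 1 ->
  differentiable f u -> differentiable (fun u => w (f u)) u.
Proof.
by move=> dw df; apply: (differentiable_comp df); apply/derivable1_diffP.
Qed.

Lemma partial_comp1 (w : R -> R) f u a : derivable w (f u) 1 ->
  differentiable f u ->
  partial a (fun u => w (f u)) u = derive1 w (f u) * partial a f u.
Proof.
move=> /derivable1_diffP dw df; rewrite partialE; last exact: differentiable_comp.
rewrite diff_comp //= -partialE //.
by rewrite -[X in 'd _ _ X]mulr1 [LHS]linearZ /= -derive1E' // mulrC.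
Qed.

Lemma Ck_on_comp1 (w : R -> R) k D f : open D -> smooth_on_pos w ->
  (forall u, D u -> 0 < f u) -> Ck_on k D f -> Ck_on k D (fun u => w (f u)).
Proof.
move=> oD sw f0.
(* The chain rule replaces [w] by its derivative, so the induction has to treat all iterated
   derivatives of [w] at once. *)
suff H j : Ck_on k D f -> Ck_on k D (fun u => derive1n j w (f u)) by exact: (H 0%N).
elim: k j => [|k IH] j.
  move=> cf u Du; apply: continuous_comp; first exact: cf.
  by apply/differentiable_continuous/derivable1_diffP/sw/f0.
move=> cf1; have [df cf] := cf1; apply: Ck_onS_intro => // [u Du|a].
  by apply: differentiable_comp1; [exact/sw/f0|exact: df].
exists (fun u => derive1n j.+1 w (f u) * partial a f u).
  by move=> u Du; rewrite partial_comp1 //; [exact/sw/f0|exact: df].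
by apply: Ck_onM => //; [exact: IH (Ck_onW cf1)|exact: cf].
Qed.

Lemma smooth_on_partial D f a : smooth_on D f -> smooth_on D (partial a f).
Proof. by move=> sf k; have [_] := sf k.+1; apply. Qed.

Lemma smooth_on_differentiable D f u : smooth_on D f -> D u -> differentiable f u.
Proof. by move=> sf Du; have [+ _] := sf 1%N; apply. Qed.

Lemma smooth_on_eq D f g : open D -> (forall u, D u -> f u = g u) ->
  smooth_on D f -> smooth_on D g.
Proof. by move=> oD fg sf k; apply: Ck_on_eq (sf k). Qed.

Lemma Ck_on_sub k D D' f : D' `<=` D -> Ck_on k D f -> Ck_on k D' f.
Proof.
move=> sD; elim: k f => [|k IH] f /=; first by move=> cf u /sD; exact: cf.
by move=> [df cf]; split=> [u /sD|a]; [exact: df|exact: IH].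
Qed.

Lemma smooth_on_sub D D' f : D' `<=` D -> smooth_on D f -> smooth_on D' f.
Proof. by move=> sD sf k; apply: Ck_on_sub (sf k). Qed.

Lemma smooth_on_cst D c : smooth_on D (fun _ => c).
Proof. by move=> k; apply: Ck_on_cst. Qed.

Lemma smooth_on_coord D a : smooth_on D (fun u => u 0 a).
Proof. by move=> k; apply: Ck_on_coord. Qed.

Lemma smooth_onD D f g : open D -> smooth_on D f -> smooth_on D g ->
  smooth_on D (fun u => f u + g u).
Proof. by move=> oD sf sg k; apply: Ck_onD. Qed.

Lemma smooth_onM D f g : open D -> smooth_on D f -> smooth_on D g ->
  smooth_on D (fun u => f u * g u).
Proof. by move=> oD sf sg k; apply: Ck_onM. Qed.

Lemma smooth_onV D f : open D -> (forall u, D u -> f u != 0) -> smooth_on D f ->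
  smooth_on D (fun u => (f u)^-1).
Proof. by move=> oD f0 sf k; apply: Ck_onV. Qed.

Lemma smooth_on_comp1 (w : R -> R) D f : open D -> smooth_on_pos w ->
  (forall u, D u -> 0 < f u) -> smooth_on D f -> smooth_on D (fun u => w (f u)).
Proof. by move=> oD sw f0 sf k; apply: Ck_on_comp1. Qed.

Lemma smooth_on_sum (I : Type) (r : seq I) (P : pred I) D (f : I -> 'rV[R]_m -> R) :
  open D -> (forall i, P i -> smooth_on D (f i)) ->
  smooth_on D (fun u => \sum_(i <- r | P i) f i u).
Proof.
move=> oD sf; rewrite -fct_sumE; elim/big_ind : _ => //.
- exact: smooth_on_cst.
- by move=> *; apply: smooth_onD.
Qed.

Lemma smooth_on_prod (I : Type) (r : seq I) (P : pred I) D (f : I -> 'rV[R]_m -> R) :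
  open D -> (forall i, P i -> smooth_on D (f i)) ->
  smooth_on D (fun u => \prod_(i <- r | P i) f i u).
Proof.
move=> oD sf; rewrite -fct_prodE; elim/big_ind : _ => //.
- exact: smooth_on_cst.
- by move=> *; apply: smooth_onM.
Qed.

End Smoothness.

(** * Symmetry of second partial derivatives *)

Section Schwarz.
Context {R : realType} {m : nat}.
Implicit Types (D : set 'rV[R]_m) (f : 'rV[R]_m -> R).

(** Restriction to a line and directional derivative have literally the same difference quotients.
    This gives access to the one-variable mean value theorem. *)
Lemma is_derive_line f v w s : differentiable f (s *: v + w) ->
  is_derive s 1 (fun s => f (s *: v + w)) ('D_v f (s *: v + w)).
Proof.
move=> /diff_derivable-/(_ v) df.
have E : (fun h => h^-1 *: (((fun s => f (s *: v + w)) \o shift s) (h *: 1) -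
    f (s *: v + w))) =
  (fun h => h^-1 *: ((f \o shift (s *: v + w)) (h *: v) - f (s *: v + w))).
  by apply/funext => h /=; rewrite [h *: 1]mulr1 scalerDl addrA.
by split; [rewrite /derivable E|rewrite /derive E].
Qed.

Lemma mean_value (F dF : R -> R) (h : R) : 0 < h ->
  (forall s : R, 0 <= s <= h -> is_derive s 1 F (dF s)) ->
  exists2 s, 0 < s < h & F h - F 0 = h * dF s.
Proof.
move=> h0 dF'.
have [||s] := @MVT R F dF 0 h h0.
- by move=> x; rewrite in_itv /= => /andP[x0 xh]; apply: dF'; apply/andP; split; exact: ltW.
- apply: derivable_within_continuous => x; rewrite in_itv /= => xh.
  by have [] := dF' _ xh.
- by rewrite in_itv /= subr0 => sh ->; exists s => //; rewrite mulrC.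
Qed.

(** The mean value theorem is applied twice: in [s] to the increment of [f] across the height [h],
    then in [t] to the partial derivative found at the intermediate [s]. *)
Lemma second_difference f a b u (h : R) : 0 < h ->
  let P s t := s *: delta_mx 0 a + (t *: delta_mx 0 b + u) in
  (forall s t, 0 <= s <= h -> 0 <= t <= h ->
     differentiable f (P s t) /\ differentiable (partial a f) (P s t)) ->
  exists s t, [/\ 0 <= s <= h, 0 <= t <= h &
    f (P h h) - f (P h 0) - (f (P 0 h) - f (P 0 0)) =
    h * (h * partial b (partial a f) (P s t))].
Proof.
move=> h0 P dP.
have h00 : 0 <= (0 : R) <= h by rewrite lexx ltW.
have hh : 0 <= h <= h by rewrite lexx ltW.
have [|s sh E1] := @mean_value (fun s => f (P s h) - f (P s 0))
    (fun s => partial a f (P s h) - partial a f (P s 0)) h h0.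
  move=> s sh; have [d1 _] := dP s h sh hh; have [d2 _] := dP s 0 sh h00.
  by apply: is_deriveB; exact: is_derive_line.
have sh' : 0 <= s <= h by case/andP: sh => ? ?; apply/andP; split; exact: ltW.
have [|t th E2] := @mean_value (fun t => partial a f (P s t))
    (fun t => partial b (partial a f) (P s t)) h h0.
  move=> t th; have [_] := dP s t sh' th; rewrite /P addrCA => d1.
  have := is_derive_line d1; rewrite /partial.
  by under eq_fun do rewrite addrCA.
have th' : 0 <= t <= h by case/andP: th => ? ?; apply/andP; split; exact: ltW.
by exists s, t; split => //; rewrite E1 E2.
Qed.

Lemma dist_lt_half (x y z e : R) : `|x - z| < e / 2 -> `|y - z| < e / 2 -> `|x - y| <= e.
Proof.
move=> xz yz; apply: le_trans (ler_distD z x y) _; rewrite (splitr e) lerD //.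
  exact: ltW.
by rewrite distrC ltW.
Qed.

(* The second difference does not change when [a] and [b] are exchanged. *)
Lemma schwarz f D u a b : open D -> D u -> smooth_on D f ->
  partial a (partial b f) u = partial b (partial a f) u.
Proof.
move=> oD Du sf; apply/eqP; rewrite -subr_eq0 -normr_le0; apply/ler_addgt0Pl => e e0.
rewrite addr0.
have sc c d : partial c (partial d f) w @[w --> u] --> partial c (partial d f) u.
  exact: (smooth_on_partial c (smooth_on_partial d sf) 0%N).
have e2 : 0 < e / 2 by lra.
have nD : nbhs u D by exact: open_nbhs_nbhs.
pose Q c d := [set w | `|partial c (partial d f) u - partial c (partial d f) w| < e / 2].
have nQ c d : nbhs u (Q c d) by exact: (@cvgr_dist_lt _ _ _ _ _ _ _ (sc c d)).
have nDE : nbhs u (D `&` (Q a b `&` Q b a)).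
  by apply: filterI => //; apply: filterI; exact: nQ.
have [r /= r0 rD] := (nbhs_ballP _ _).1 nDE.
(* A step of the square moves the point by at most [h] times the sum of the norms of the two basis
   vectors. The summand 1 makes [c] positive, and the factor 2 in [h] gives [h * c = r / 2], so the
   closed square stays inside the ball. *)
pose c : R := `|delta_mx 0 a : 'rV[R]_m| + `|delta_mx 0 b : 'rV[R]_m| + 1.
have c0 : 0 < c by rewrite /c ltr_wpDl ?addr_ge0.
pose h := r / (2 * c).
have h0 : 0 < h by rewrite divr_gt0 // mulr_gt0.
have hr : h * c < r by rewrite /h invfM mulrA divfK ?gt_eqF //; lra.
have bound s t : 0 <= s <= h -> 0 <= t <= h ->
    ball u r (s *: delta_mx 0 a + (t *: delta_mx 0 b + u)).
  move=> /andP[s0 sh] /andP[t0 th].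
  rewrite -ball_normE /= addrA opprD addrCA subrr addr0 normrN.
  apply: le_lt_trans hr; apply: le_trans (ler_normD _ _) _.
  rewrite !normrZ !ger0_norm // /c mulrDr mulrDr mulr1.
  have sa : s * `|delta_mx 0 a : 'rV[R]_m| <= h * `|delta_mx 0 a : 'rV[R]_m|.
    exact: ler_wpM2r.
  have tb : t * `|delta_mx 0 b : 'rV[R]_m| <= h * `|delta_mx 0 b : 'rV[R]_m|.
    exact: ler_wpM2r.
  by move: sa tb; lra.
have dD w : D w -> differentiable f w by exact: smooth_on_differentiable.
have dpD k w : D w -> differentiable (partial k f) w.
  by apply: smooth_on_differentiable; exact: smooth_on_partial.
have [|s [t [sh th E]]] := @second_difference f a b u h h0.
  by move=> s t sh th; have [/= Dw _] := rD _ (bound s t sh th); split; [exact: dD|exact: dpD].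
have [|s' [t' [sh' th' E']]] := @second_difference f b a u h h0.
  move=> s' t' sh' th'; have := rD _ (bound t' s' th' sh').
  by rewrite addrCA => -[/= Dw _]; split; [exact: dD|exact: dpD].
(* Both mixed derivatives come from the same second difference, so they agree at two points of the
   square, in general different ones. Each value is within [e / 2] of the corresponding mixed
   derivative at [u]. *)
have {E E'} EE : partial b (partial a f) (s *: delta_mx 0 a + (t *: delta_mx 0 b + u)) =
   partial a (partial b f) (s' *: delta_mx 0 b + (t' *: delta_mx 0 a + u)).
  have hn : h != 0 by rewrite gt_eqF.
  apply: (mulfI hn); apply: (mulfI hn).
  apply: (etrans (esym E)); apply: (etrans _ E').
  rewrite ![_ *: delta_mx 0 b + (_ *: delta_mx 0 a + _)]addrCA.
  by rewrite [in LHS]opprB [in RHS]opprB; ring.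
have [_ [/= _ H1]] := rD _ (bound s t sh th).
have [_ [/= + _]] := rD _ (bound t' s' th' sh').
rewrite addrCA /Q /= -EE => H2.
exact: dist_lt_half H2 H1.
Qed.

End Schwarz.

(** * Smooth matrix-valued functions *)

Section SmoothMatrices.
Context {R : realType} {m : nat}.
Implicit Types (D : set 'rV[R]_m).

Definition smooth_mx p q D (F : 'rV[R]_m -> 'M[R]_(p, q)) :=
  forall a b, smooth_on D (fun u => F u a b).

Variables (D : set 'rV[R]_m) (oD : open D).

Lemma smooth_mx_eq p q (F G : 'rV[R]_m -> 'M[R]_(p, q)) :
  (forall u, D u -> F u = G u) -> smooth_mx D F -> smooth_mx D G.
Proof.
by move=> FG sF a b; apply: smooth_on_eq (sF a b) => // u Du; rewrite FG.
Qed.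

Lemma smooth_mx_cst p q (C : 'M[R]_(p, q)) : smooth_mx D (fun=> C).
Proof. by move=> a b; exact: smooth_on_cst. Qed.

Lemma smooth_mxD p q (F G : 'rV[R]_m -> 'M[R]_(p, q)) :
  smooth_mx D F -> smooth_mx D G -> smooth_mx D (fun u => F u + G u).
Proof.
move=> sF sG a b; under eq_fun do rewrite mxE; exact: smooth_onD.
Qed.

Lemma smooth_mxZ p q (f : 'rV[R]_m -> R) (F : 'rV[R]_m -> 'M[R]_(p, q)) :
  smooth_on D f -> smooth_mx D F -> smooth_mx D (fun u => f u *: F u).
Proof.
move=> sf sF a b; under eq_fun do rewrite mxE; exact: smooth_onM.
Qed.

Lemma smooth_mxN p q (F : 'rV[R]_m -> 'M[R]_(p, q)) :
  smooth_mx D F -> smooth_mx D (fun u => - F u).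
Proof.
move=> sF; under eq_fun do rewrite -scaleN1r.
by apply: smooth_mxZ => //; exact: smooth_on_cst.
Qed.

Lemma smooth_mx_tr p q (F : 'rV[R]_m -> 'M[R]_(p, q)) :
  smooth_mx D F -> smooth_mx D (fun u => (F u)^T).
Proof. by move=> sF a b; under eq_fun do rewrite mxE; exact: sF. Qed.

Lemma smooth_mxM p q r (F : 'rV[R]_m -> 'M[R]_(p, q)) (G : 'rV[R]_m -> 'M[R]_(q, r)) :
  smooth_mx D F -> smooth_mx D G -> smooth_mx D (fun u => F u *m G u).
Proof.
move=> sF sG a b; under eq_fun do rewrite mxE.
by apply: smooth_on_sum => // k _; exact: smooth_onM.
Qed.

Lemma smooth_mx_block p1 p2 q1 q2 (F11 : 'rV[R]_m -> 'M[R]_(p1, q1))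
    (F12 : 'rV[R]_m -> 'M[R]_(p1, q2)) (F21 : 'rV[R]_m -> 'M[R]_(p2, q1))
    (F22 : 'rV[R]_m -> 'M[R]_(p2, q2)) :
  smooth_mx D F11 -> smooth_mx D F12 -> smooth_mx D F21 -> smooth_mx D F22 ->
  smooth_mx D (fun u => block_mx (F11 u) (F12 u) (F21 u) (F22 u)).
Proof.
move=> s11 s12 s21 s22 a b.
case: (split_ordP a) => a' ->; case: (split_ordP b) => b' ->.
- by under eq_fun do rewrite block_mxEul; exact: s11.
- by under eq_fun do rewrite block_mxEur; exact: s12.
- by under eq_fun do rewrite block_mxEdl; exact: s21.
- by under eq_fun do rewrite block_mxEdr; exact: s22.
Qed.

Lemma smooth_det p (F : 'rV[R]_m -> 'M[R]_p) :
  smooth_mx D F -> smooth_on D (fun u => \det (F u)).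
Proof.
move=> sF; apply: smooth_on_sum => // s _; apply: smooth_onM => //.
  exact: smooth_on_cst.
by apply: smooth_on_prod => // i _; exact: sF.
Qed.

(** Cramer's rule: on [D] the inverse is the adjugate divided by a nonvanishing determinant, and
    both are polynomial in the entries of [F]. *)
Lemma smooth_mx_inv p (F : 'rV[R]_m -> 'M[R]_p) :
  (forall u, D u -> F u \in unitmx) ->
  smooth_mx D F -> smooth_mx D (fun u => invmx (F u)).
Proof.
move=> uF sF; apply: (@smooth_mx_eq _ _ (fun u => (\det (F u))^-1 *: \adj (F u))).
  by move=> u Du; rewrite /invmx uF.
apply: smooth_mxZ.
  apply: smooth_onV => //; last exact: smooth_det.
  by move=> u /uF; rewrite unitmxE unitfE.
move=> a b; under eq_fun do rewrite mxE; apply: smooth_onM => //.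
  exact: smooth_on_cst.
apply: smooth_det => i j; under eq_fun do rewrite !mxE; exact: sF.
Qed.

End SmoothMatrices.

(** * Functions of the base coordinates seen on the total space *)

Section Pullback.
Context {R : realType} {n k : nat}.

Lemma jacobian_lsubmx (u : 'rV[R]_(n + k)) a b :
  jacobian (lsubmx : 'rV[R]_(n + k) -> 'rV[R]_n) u a b = (lshift k b == a)%:R.
Proof.
rewrite jacobianE; last exact: differentiable_lsubmx.
by under eq_fun do rewrite mxE; exact: partial_coord.
Qed.

Lemma partial_lsubmx (f : 'rV[R]_n -> R) (u : 'rV[R]_(n + k)) a :
  differentiable f (lsubmx u) ->
  partial (lshift k a) (f \o lsubmx) u = partial a f (lsubmx u).
Proof.
move=> df; rewrite partial_comp //; last exact: differentiable_lsubmx.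
rewrite (bigD1 a) //= jacobian_lsubmx eqxx mul1r big1 ?addr0 // => b ba.
by rewrite jacobian_lsubmx (inj_eq (@lshift_inj _ _)) (negbTE ba) mul0r.
Qed.

Lemma partial_lsubmx0 (f : 'rV[R]_n -> R) (u : 'rV[R]_(n + k)) a :
  differentiable f (lsubmx u) -> partial (rshift n a) (f \o lsubmx) u = 0.
Proof.
move=> df; rewrite partial_comp //; last exact: differentiable_lsubmx.
by rewrite big1 // => b _; rewrite jacobian_lsubmx eq_lrshift mul0r.
Qed.

Lemma open_lsubmx (D : set 'rV[R]_n) : open D ->
  open (lsubmx @^-1` D : set 'rV[R]_(n + k)).
Proof. by move=> oD; apply: open_comp => // u _; exact: continuous_lsubmx. Qed.

(** The induction closes because a partial derivative along the base is again such a pullback, of a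
    partial derivative of [f], and one along the fibre is zero. *)
Lemma smooth_on_lsubmx (D : set 'rV[R]_n) (f : 'rV[R]_n -> R) : open D ->
  smooth_on D f -> smooth_on (lsubmx @^-1` D : set 'rV[R]_(n + k)) (fun u => f (lsubmx u)).
Proof.
move=> oD sf l; have oD' := open_lsubmx oD.
elim: l f sf => [|l IH] f sf.
  move=> u Du; apply: continuous_comp; first exact: continuous_lsubmx.
  exact: (sf 0%N).
have df u : D u -> differentiable f u by exact: smooth_on_differentiable.
apply: Ck_onS_intro => // [u Du|a].
  by apply: (@differentiable_comp _ _ _ _ lsubmx f); [exact: differentiable_lsubmx|exact: df].
case: (split_ordP a) => a' ->.
  exists (fun u => partial a' f (lsubmx u)); last exact/IH/smooth_on_partial.
  by move=> u Du; rewrite partial_lsubmx //; exact: df.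
exists (fun=> 0); last exact: Ck_on_cst.
by move=> u Du; rewrite partial_lsubmx0 //; exact: df.
Qed.

End Pullback.

(** * Charts and Jacobians *)

(* A sealed copy of [jac]: unification otherwise unfolds the differentials. *)
HB.lock Definition tjac (R : realType) (m : nat) (N : atlas R m) (i j : chart N) (x : N) :
  'M[R]_m := jac i j x.

Section Charts.
Context {R : realType} {m : nat} {N : atlas R m}.
Implicit Types (i j k : chart N) (x : N).

Lemma readM i (f g : N -> R) :
  read i (fun x => f x * g x) = fun u => read i f u * read i g u.
Proof. by apply/funext => u; rewrite /read; case: pselect => // e; rewrite mulr0. Qed.

Lemma read_sum I (r : seq I) i (f : I -> N -> R) :
  read i (fun x => \sum_(l <- r) f l x) = fun u => \sum_(l <- r) read i (f l) u.
Proof. by apply/funext => u; rewrite /read; case: pselect => // e; rewrite big1. Qed.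

Lemma read_mxE p q i (F : N -> 'M[R]_(p, q)) u a b :
  read i F u a b = read i (fun x => F x a b) u.
Proof. by rewrite /read; case: pselect => // e; rewrite mxE. Qed.

(** Only injectivity at the point [x] is asked for, so that the lemma applies to the induced charts
    before they are known to form a manifold. *)
Lemma read_injective (V : zmodType) i (f : N -> V) x :
  (forall y, dom i y -> coord i y = coord i x -> y = x) ->
  dom i x -> read i f (coord i x) = f x.
Proof.
move=> inj ix; rewrite /read; case: pselect => [e|]; last by case; exists x.
by congr f; case: (cid2 e) => y iy /= /(inj _ iy).
Qed.

Hypothesis hN : smooth_manifold N.

Lemma coord_injective i x y : dom i x -> dom i y -> coord i x = coord i y -> x = y.
Proof. by case: hN => inj _ _ _ ix iy; apply: inj; rewrite inE. Qed.

Lemma read_coord (V : zmodType) i (f : N -> V) x : dom i x ->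
  read i f (coord i x) = f x.
Proof.
by move=> ix; apply: read_injective => // y iy /coord_injective; apply.
Qed.

Lemma image_in_coord i (S : set N) x : dom i x -> S x -> image_in i S (coord i x).
Proof. by move=> ix Sx; exists x. Qed.

Lemma open_overlap i j : open (image_in i (dom j)).
Proof. by case: hN => _ [+ _] _ _; apply. Qed.

Lemma open_image i : open (image_in i setT).
Proof.
have -> : image_in i setT = image_in i (dom i) by rewrite /image_in setIT setIid.
exact: open_overlap.
Qed.

Lemma exists_chart x : exists i, dom i x.
Proof. by case: hN => _ _ _ [C [_ /(_ x)[i _ ix]]]; exists i. Qed.

Lemma smooth_transition i j a :
  smooth_on (image_in i (dom j)) (fun u => read i (coord j) u 0 a).
Proof. by case: hN => _ [_ +] _ _; apply. Qed.

Lemma differentiable_transition i j x : dom i x -> dom j x ->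
  differentiable (read i (coord j)) (coord i x).
Proof.
move=> ix jx; apply: differentiable_rowP => b.
apply: smooth_on_differentiable (@smooth_transition i j b) _.
exact: image_in_coord.
Qed.

(** The equality holds over the overlap of the two charts, which is open; elsewhere the values
    extended by 0 need not match. *)
Lemma read_transition (V : zmodType) i j (f : N -> V) x : dom i x -> dom j x ->
  {near coord i x, read i f =1 read j f \o read i (coord j)}.
Proof.
move=> ix jx; apply: (@open_near_eq _ _ (image_in i (dom j))).
- exact: open_overlap.
- exact: image_in_coord.
- by move=> _ [y [iy jy] <-] /=; rewrite !read_coord.
Qed.

Lemma differentiable_read i j (f : N -> R) x : dom i x -> dom j x ->
  differentiable (read j f) (coord j x) -> differentiable (read i f) (coord i x).
Proof.
move=> ix jx df.
apply: (@near_eq_differentiable _ _ _ (read j f \o read i (coord j))).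
  by apply: filterS (@read_transition _ i j f _ ix jx) => y ->.
apply: differentiable_comp; first exact: differentiable_transition.
by rewrite read_coord.
Qed.

Lemma jac_tjac i j x : jac i j x = tjac i j x.
Proof. by rewrite unlock. Qed.

Lemma partial_at_transition i j (f : N -> R) x a : dom i x -> dom j x ->
  differentiable (read j f) (coord j x) ->
  partial_at i a f x = \sum_b tjac i j x a b * partial_at j b f x.
Proof.
move=> ix jx df; rewrite /partial_at (partial_near _ (@read_transition _ i j f _ ix jx)).
rewrite partial_comp ?read_coord //; last exact: differentiable_transition.
by under eq_bigr do rewrite -[jacobian _ _]/(jac _ _ _) jac_tjac.
Qed.

Lemma tjac_partial i j x a b : dom i x -> dom j x ->
  tjac i j x a b = partial a (fun u => read i (coord j) u 0 b) (coord i x).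
Proof.
by move=> ix jx; rewrite -jac_tjac /jac jacobianE //; exact: differentiable_transition.
Qed.

Lemma tjacE i j x a b : dom i x -> dom j x ->
  tjac i j x a b = partial_at i a (fun y => coord j y 0 b) x.
Proof.
move=> ix jx; rewrite tjac_partial // /partial_at.
by under eq_fun do rewrite read_mxE.
Qed.

Lemma smooth_in_differentiable i (f : N -> R) x : dom i x -> smooth_in i f ->
  differentiable (read i f) (coord i x).
Proof.
by move=> ix sf; apply: smooth_on_differentiable sf _; exact: image_in_coord.
Qed.

Lemma differentiable_coord_fun i j a x : dom i x -> dom j x ->
  differentiable (read i (fun y => coord j y 0 a)) (coord i x).
Proof.
move=> ix jx.
have -> : read i (fun y => coord j y 0 a) = fun u => read i (coord j) u 0 a.
  by apply/funext => u; rewrite read_mxE.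
apply: smooth_on_differentiable (@smooth_transition i j a) _.
exact: image_in_coord.
Qed.

(** The rows of [tjac j k] are partial derivatives of the coordinates of [k], so this is the chain
    rule applied to those coordinate functions. *)
Lemma tjac_comp i j k x : dom i x -> dom j x -> dom k x ->
  tjac i j x *m tjac j k x = tjac i k x.
Proof.
move=> ix jx kx; apply/matrixP => a b; rewrite [LHS]mxE [RHS]tjacE //.
rewrite (@partial_at_transition i j) //; last exact: differentiable_coord_fun.
by apply: eq_bigr => c _; rewrite [X in _ * X]tjacE.
Qed.

Lemma tjac_id i x : dom i x -> tjac i i x = 1%:M.
Proof.
move=> ix; apply/matrixP => a b; rewrite tjacE // [RHS]mxE /partial_at.
rewrite (@partial_near _ _ _ _ (fun u => u 0 b)); first by rewrite partial_coord eq_sym.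
apply: (@open_near_eq _ _ (image_in i setT)).
- exact: open_image.
- exact: image_in_coord.
- by move=> _ [y [iy _] <-] /=; rewrite read_coord.
Qed.

Lemma tjacK i j x : dom i x -> dom j x -> tjac i j x *m tjac j i x = 1%:M.
Proof. by move=> ix jx; rewrite tjac_comp // tjac_id. Qed.

Lemma tjac_unit i j x : dom i x -> dom j x -> tjac i j x \in unitmx.
Proof. by move=> ix jx; have [u _] := mulmx1_unit (tjacK ix jx); exact: u. Qed.

Lemma tjac_inv i j x : dom i x -> dom j x -> tjac j i x = invmx (tjac i j x).
Proof.
move=> ix jx; apply: (can_inj (mulKmx (tjac_unit ix jx))).
by rewrite tjacK // mulmxV // tjac_unit.
Qed.

Lemma smooth_tjac i j : smooth_mx (image_in i (dom j)) (read i (tjac i j)).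
Proof.
move=> a b; apply: (@smooth_on_eq _ _ _ (partial a (fun u => read i (coord j) u 0 b))).
- exact: open_overlap.
- by move=> _ [x [ix jx] <-]; rewrite read_coord // tjac_partial.
- exact/smooth_on_partial/smooth_transition.
Qed.

(** [tjac j i] is differentiated in chart [j] but read in chart [i]. Passing through the matrix
    inverse of [tjac i j] avoids composing smooth functions with the transition map. *)
Lemma smooth_tjac_inv i j : smooth_mx (image_in i (dom j)) (read i (tjac j i)).
Proof.
apply: (@smooth_mx_eq _ _ _ _ _ _ (fun u => invmx (read i (tjac i j) u))).
- exact: open_overlap.
- by move=> _ [x [ix jx] <-]; rewrite !read_coord // -tjac_inv.
- apply: smooth_mx_inv; [exact: open_overlap| |exact: smooth_tjac].
  by move=> _ [x [ix jx] <-]; rewrite read_coord //; exact: tjac_unit.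
Qed.

Lemma differentiable_tjac i j x a b : dom i x -> dom j x ->
  differentiable (read i (fun y => tjac i j y a b)) (coord i x).
Proof.
move=> ix jx.
have -> : read i (fun y => tjac i j y a b) = fun u => read i (tjac i j) u a b.
  by apply/funext => u; rewrite read_mxE.
apply: smooth_on_differentiable (@smooth_tjac i j a b) _.
exact: image_in_coord.
Qed.

Lemma partial_tjacC i j x a b c : dom i x -> dom j x ->
  partial_at i a (fun y => tjac i j y b c) x = partial_at i b (fun y => tjac i j y a c) x.
Proof.
move=> ix jx; pose f u := read i (coord j) u 0 c.
have E d e : partial_at i d (fun y => tjac i j y e c) x = partial d (partial e f) (coord i x).
  apply: partial_near; apply: (@open_near_eq _ _ (image_in i (dom j))).
  - exact: open_overlap.
  - exact: image_in_coord.
  - by move=> _ [y [iy jy] <-]; rewrite read_coord // tjac_partial.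
rewrite !E; apply: (@schwarz _ _ _ (image_in i (dom j))).
- exact: open_overlap.
- exact: image_in_coord.
- exact: smooth_transition.
Qed.

Lemma partial_at_eq i j (f g : N -> R) x a : dom i x -> dom j x ->
  (forall y, dom i y -> dom j y -> f y = g y) ->
  partial_at i a f x = partial_at i a g x.
Proof.
move=> ix jx fg; apply: partial_near; apply: (@open_near_eq _ _ (image_in i (dom j))).
- exact: open_overlap.
- exact: image_in_coord.
- by move=> _ [y [iy jy] <-]; rewrite !read_coord // fg.
Qed.

Lemma partial_atM i a (f g : N -> R) x : dom i x ->
  differentiable (read i f) (coord i x) -> differentiable (read i g) (coord i x) ->
  partial_at i a (fun y => f y * g y) x = partial_at i a f x * g x + f x * partial_at i a g x.
Proof.
move=> ix df dg; rewrite /partial_at; rewrite readM.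
by rewrite partialM // !read_coord.
Qed.

Lemma partial_at_sum I (r : seq I) i a (f : I -> N -> R) x :
  (forall l, differentiable (read i (f l)) (coord i x)) ->
  partial_at i a (fun y => \sum_(l <- r) f l y) x = \sum_(l <- r) partial_at i a (f l) x.
Proof.
move=> df; rewrite /partial_at; rewrite read_sum; exact: partial_sum.
Qed.

Lemma differentiable_readM i (f g : N -> R) u :
  differentiable (read i f) u -> differentiable (read i g) u ->
  differentiable (read i (fun y => f y * g y)) u.
Proof.
by move=> df dg; rewrite readM; exact: differentiableM.
Qed.

Lemma differentiable_read_sum I (r : seq I) i (f : I -> N -> R) u :
  (forall l, differentiable (read i (f l)) u) ->
  differentiable (read i (fun y => \sum_(l <- r) f l y)) u.
Proof.
by move=> df; rewrite read_sum; exact: differentiable_fsum.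
Qed.

End Charts.

(** * The transformation law of the Christoffel symbols *)

(* [J] stands for the Jacobian of a change of chart, [T a b c] for the second
   derivative d_a d_b of its c-th coordinate, and [D a b c] for d_a g_bc. *)
Section ChristoffelAlgebra.
Context {F : fieldType} {n : nat}.
Implicit Types (T D : 'I_n -> 'I_n -> 'I_n -> F) (J G : 'M[F]_n).

(** The Christoffel symbols of the first kind. They involve no inverse metric, so the change of
    chart is first worked out for them. *)
Definition lowered_christoffel D h a b : F := 2^-1 * (D a h b + D b a h - D h a b).

(** [U] collects the terms with second derivatives of the coordinates and is symmetric in its first
    two arguments. In the alternating combination four of the six [U]-terms cancel and the other two
    add up to twice [U a b h]. *)
Lemma lowered_christoffel_transition T D D' J G :
  (2 : F) != 0 ->
  (forall a b c, T a b c = T b a c) ->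
  (forall a b, G a b = G b a) ->
  let U x y z := \sum_c T x y c * \sum_d G c d * J z d in
  (forall x y z, D x y z = U x y z + U x z y +
     \sum_c \sum_d \sum_e J x c * J y d * J z e * D' c d e) ->
  forall h a b, lowered_christoffel D h a b =
    \sum_c J h c * (\sum_d \sum_e J a d * J b e * lowered_christoffel D' c d e
      + \sum_d G c d * T a b d).
Proof.
move=> two0 Tsym Gsym U DE h a b.
have Usym x y z : U x y z = U y x z.
  by apply: eq_bigr => c _; rewrite Tsym.
have -> : lowered_christoffel D h a b = 2^-1 *
    (\sum_c \sum_d \sum_e J a c * J h d * J b e * D' c d e +
     \sum_c \sum_d \sum_e J b c * J a d * J h e * D' c d e -
     \sum_c \sum_d \sum_e J h c * J a d * J b e * D' c d e) + U a b h.
  rewrite /lowered_christoffel !DE (Usym h a) (Usym h b) (Usym b a).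
  set s1 := \sum_c _; set s2 := \sum_c _; set s3 := \sum_c _.
  by field.
(* The summation indices are renamed so that all three sums carry the coefficient
   [J h c * J a d * J b e] and the whole expression factors through row [h] of [J]. *)
have E1 : \sum_c \sum_d \sum_e J a c * J h d * J b e * D' c d e =
    \sum_c \sum_d \sum_e J h c * J a d * J b e * D' d c e.
  rewrite exchange_big; apply: eq_bigr => c _; apply: eq_bigr => d _.
  by apply: eq_bigr => e _; rewrite (mulrC (J a d)).
have E2 : \sum_c \sum_d \sum_e J b c * J a d * J h e * D' c d e =
    \sum_c \sum_d \sum_e J h c * J a d * J b e * D' e d c.
  under eq_bigr do rewrite exchange_big; rewrite exchange_big; apply: eq_bigr => c _.
  rewrite exchange_big; apply: eq_bigr => d _; apply: eq_bigr => e _; ring.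
have E3 : U a b h = \sum_c J h c * \sum_d G c d * T a b d.
  rewrite /U; under eq_bigr do rewrite mulr_sumr.
  rewrite exchange_big; apply: eq_bigr => c _; rewrite mulr_sumr.
  by apply: eq_bigr => d _; rewrite (Gsym c d); ring.
rewrite E1 E2 E3 -big_split -sumrB mulr_sumr -big_split; apply: eq_bigr => c _.
rewrite [RHS]mulrDr; congr (_ + _).
rewrite -big_split -sumrB !mulr_sumr; apply: eq_bigr => d _.
rewrite -big_split -sumrB !mulr_sumr; apply: eq_bigr => e _.
by rewrite /lowered_christoffel /=; ring.
Qed.

(** Raising the index: in the product of [p' *m J^T], the inverse of [J *m G *m J^T] and [J *m V],
    the outer Jacobians cancel and [p' *m invmx G *m V] remains. In the part of [V] containing [T]
    the factor [G] cancels as well, which leaves [p'] contracted with the second derivatives. *)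
Lemma christoffel_transition T D D' J G p' :
  (2 : F) != 0 -> J \in unitmx -> G \in unitmx ->
  (forall a b c, T a b c = T b a c) ->
  (forall a b, G a b = G b a) ->
  let U x y z := \sum_c T x y c * \sum_d G c d * J z d in
  (forall x y z, D x y z = U x y z + U x z y +
     \sum_c \sum_d \sum_e J x c * J y d * J z e * D' c d e) ->
  let Gamma (g : 'M[F]_n) D (p : 'rV[F]_n) := \matrix_(a, b)
     \sum_k p 0 k * (2^-1 * \sum_h invmx g k h * (D a h b + D b a h - D h a b)) in
  forall a b, Gamma (J *m G *m J^T) D (p' *m J^T) a b =
    (J *m Gamma G D' p' *m J^T) a b + \sum_c p' 0 c * T a b c.
Proof.
move=> two0 uJ uG Tsym Gsym U DE Gamma.
have GammaE g E (p : 'rV_n) a b : Gamma g E p a b =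
    (p *m (invmx g *m \col_h lowered_christoffel E h a b)) 0 0.
  rewrite !mxE; apply: eq_bigr => k _; congr (_ * _); rewrite !mxE mulr_sumr.
  by apply: eq_bigr => h _; rewrite !mxE /lowered_christoffel mulrCA.
move=> a b; rewrite GammaE.
pose V := \col_c (\sum_d \sum_e J a d * J b e * lowered_christoffel D' c d e
      + \sum_d G c d * T a b d).
have -> : \col_h lowered_christoffel D h a b = J *m V.
  apply/matrixP => h k; rewrite !mxE.
  rewrite (lowered_christoffel_transition two0 Tsym Gsym DE).
  by apply: eq_bigr => c _; rewrite mxE.
have uJT : J^T \in unitmx by rewrite unitmx_tr.
have uGJ : G *m J^T \in unitmx by rewrite unitmx_mul uG.
have uJG : J *m G \in unitmx by rewrite unitmx_mul uJ.
have -> : p' *m J^T *m (invmx (J *m G *m J^T) *m (J *m V)) = p' *m (invmx G *m V).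
  have -> : J *m V = (J *m G *m J^T) *m (invmx J^T *m (invmx G *m V)).
    by rewrite -!mulmxA mulKVmx // mulKVmx.
  by rewrite mulKmx ?unitmx_mul ?uJ ?uG // -mulmxA mulKVmx.
have -> : V = \sum_d \sum_e (J a d * J b e) *: (\col_c lowered_christoffel D' c d e)
    + G *m (\col_d T a b d).
  apply/matrixP => c k; rewrite !mxE; congr (_ + _).
    rewrite summxE; apply: eq_bigr => d _; rewrite summxE; apply: eq_bigr => e _.
    by rewrite !mxE.
  by apply: eq_bigr => d _; rewrite !mxE.
rewrite mulmxDr mulKmx // mulmxDr mxE; congr (_ + _); last first.
  by rewrite mxE; apply: eq_bigr => c _; rewrite mxE.
rewrite !mulmx_sumr summxE [RHS]mxE.
under [RHS]eq_bigr do rewrite mxE mulr_suml.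
rewrite exchange_big; apply: eq_bigr => d _.
rewrite !mulmx_sumr summxE; apply: eq_bigr => e _.
by rewrite -!scalemxAr mxE -GammaE [J^T _ _]mxE mulrAC.
Qed.

End ChristoffelAlgebra.

(** * Positive definite forms *)

Section PositiveDefinite.
Context {R : realType} {n : nat}.
Implicit Types (G : 'M[R]_n) (X Y p : 'rV[R]_n).

Definition posdef G := forall X, X != 0 -> 0 < beval G X X.

Lemma posdef_unit G : posdef G -> G \in unitmx.
Proof.
move=> Gpos; rewrite unitmxE unitfE; apply/negP => /det0P[X X0 XG].
by have := Gpos X X0; rewrite /beval XG mul0mx mxE ltxx.
Qed.

Lemma posdef_ge0 G X : posdef G -> 0 <= beval G X X.
Proof.
move=> Gpos; have [->|/Gpos/ltW//] := eqVneq X 0.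
by rewrite /beval mul0mx mul0mx mxE.
Qed.

Lemma beval_conj q (P : 'M[R]_(q, n)) G (X Y : 'rV[R]_q) :
  (X *m (P *m G *m P^T) *m Y^T) 0 0 = beval G (X *m P) (Y *m P).
Proof. by rewrite /beval trmx_mul !mulmxA. Qed.

Lemma posdef_conj P G : P \in unitmx -> posdef G -> posdef (P *m G *m P^T).
Proof.
move=> uP Gpos X X0; rewrite /beval beval_conj; apply: Gpos.
by apply: contraNneq X0 => XP; rewrite -(mulmxK uP X) XP mul0mx.
Qed.

(** For symmetric [G] the inverse is congruent to [G] itself, through [invmx G]. *)
Lemma posdef_inv G : G^T = G -> posdef G -> posdef (invmx G).
Proof.
move=> Gsym Gpos; have uG := posdef_unit Gpos.
have -> : invmx G = invmx G *m G *m (invmx G)^T.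
  by rewrite trmx_inv Gsym mulVmx // mul1mx.
by apply: posdef_conj; rewrite ?unitmx_inv.
Qed.

Lemma beval_sym G X Y : G^T = G -> beval G X Y = beval G Y X.
Proof.
move=> Gsym; rewrite /beval.
have -> : X *m G *m Y^T = (Y *m G *m X^T)^T by rewrite !trmx_mul trmxK Gsym mulmxA.
by rewrite [LHS]mxE.
Qed.

Lemma beval_comb G X Y (a b : R) : G^T = G ->
  beval G (a *: X - b *: Y) (a *: X - b *: Y) =
  a ^+ 2 * beval G X X - 2 * a * b * beval G X Y + b ^+ 2 * beval G Y Y.
Proof.
move=> Gsym; have E := beval_sym Y X Gsym; move: E; rewrite /beval.
rewrite [(_ - _)^T]linearB /= !mulmxBl !mulmxBr ![(_ *: _)^T]linearZ /= -!scalemxAl -!scalemxAr => E.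
by rewrite !mxE in E *; rewrite E; ring.
Qed.

Lemma cauchy_schwarz_beval G X Y : G^T = G -> posdef G ->
  beval G X Y ^+ 2 <= beval G X X * beval G Y Y.
Proof.
move=> Gsym Gpos; have [->|Y0] := eqVneq Y 0.
  by rewrite /beval trmx0 !mulmx0 !mxE mulr0 expr0n.
have YY := Gpos Y Y0.
(* This is the component of [X] orthogonal to [Y], multiplied by [beval G Y Y] to avoid a division;
   its square length is [a * (c * a - b ^+ 2)] in the notation set below. *)
have := posdef_ge0 (beval G Y Y *: X - beval G X Y *: Y) Gpos.
rewrite beval_comb //.
set a := beval G Y Y; set b := beval G X Y; set c := beval G X X.
rewrite (_ : _ + _ = a * (c * a - b ^+ 2)); last by ring.
by rewrite pmulr_rge0 // subr_ge0.
Qed.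

(* [v * s] is affine in [s = (X . p)^2], which ranges over [[0, 2 t |X|^2]] by
   Cauchy-Schwarz, and the form is positive at both ends. *)
Lemma posdef_rank_one G p (A v : R) : G^T = G -> posdef G -> p != 0 ->
  let t := 2^-1 * (p *m invmx G *m p^T) 0 0 in
  0 < A -> 0 < A + 2 * v -> posdef ((A * t) *: G + v *: (p^T *m p)).
Proof.
move=> Gsym Gpos p0 t A0 Av X X0; have uG := posdef_unit Gpos.
have t0 : 0 < t by rewrite mulr_gt0 //; exact: posdef_inv.
have XX := Gpos X X0.
(* [p *m invmx G] is the vector dual to [p]: the pairing of [X] with [p] becomes an inner product,
   and the dual vector has square length [2 * t], so Cauchy-Schwarz applies. *)
pose s := beval G X (p *m invmx G).
have sE : X *m p^T = s%:M.
  rewrite [LHS]mx11_scalar /s /beval trmx_mul trmx_inv Gsym.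
  by rewrite !mulmxA mulmxK.
have tE : beval G (p *m invmx G) (p *m invmx G) = 2 * t.
  by rewrite /t /beval trmx_mul trmx_inv Gsym !mulmxA mulmxKV //; field.
have CS : s ^+ 2 <= beval G X X * (2 * t).
  by rewrite -tE; exact: cauchy_schwarz_beval.
have pX : p *m X^T = s%:M by rewrite -[LHS]trmxK trmx_mul trmxK sE tr_scalar_mx.
have -> : beval ((A * t) *: G + v *: (p^T *m p)) X X = A * t * beval G X X + v * s ^+ 2.
  rewrite /beval mulmxDr mulmxDl -!scalemxAr -!scalemxAl mulmxA sE -(mulmxA _ p) pX.
  by rewrite -scalar_mxM !mxE eqxx mulr1n expr2.
have [v0|v0] := leP 0 v.
  apply: ltr_pwDl; first by apply: mulr_gt0 => //; exact: mulr_gt0.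
  by apply: mulr_ge0 => //; exact: sqr_ge0.
(* For negative [v] the worst case is equality in Cauchy-Schwarz. The value there is
   [t * beval G X X * (A + 2 * v)], which is where the condition on [A + 2 * v] enters. *)
have : v * (beval G X X * (2 * t)) <= v * s ^+ 2 by rewrite ler_nM2l.
rewrite -(lerD2l (A * t * beval G X X)); apply: lt_le_trans.
rewrite (_ : _ + _ = t * beval G X X * (A + 2 * v)); last by ring.
by apply: mulr_gt0 => //; exact: mulr_gt0.
Qed.

End PositiveDefinite.

Lemma posdef_block (R : realType) n1 n2 (G : 'M[R]_n1) (H : 'M[R]_n2) :
  posdef G -> posdef H -> posdef (block_mx G 0 0 H).
Proof.
move=> Gpos Hpos X X0; rewrite /beval -(hsubmxK X) mul_row_block.
rewrite !mulmx0 addr0 add0r tr_row_mx mul_row_col mxE.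
have Gge := posdef_ge0 (lsubmx X) Gpos; have Hge := posdef_ge0 (rsubmx X) Hpos.
have [l0|l0] := eqVneq (lsubmx X) 0; last exact: ltr_pwDl (Gpos _ l0) Hge.
have r0 : rsubmx X != 0.
  by apply: contraNneq X0 => r0; rewrite -(hsubmxK X) l0 r0 row_mx0.
exact: ltr_wpDl Gge (Hpos _ r0).
Qed.

(* The product rule for an entry of [J G J^T], where [T] collects the derivatives
   of [J] and [D e] is the derivative of [G] along coordinate [e] of the new chart. *)
Lemma conj_product_rule (F : comPzRingType) n (G : 'M[F]_n) (D : 'I_n -> 'I_n -> 'I_n -> F)
    (Ja Jh Jb Th Tb : 'I_n -> F) : (forall c d, G c d = G d c) ->
  \sum_d ((\sum_c (Th c * G c d + Jh c * \sum_e Ja e * D e c d)) * Jb d +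
          (\sum_c Jh c * G c d) * Tb d) =
  \sum_c Th c * (\sum_d G c d * Jb d) + \sum_c Tb c * (\sum_d G c d * Jh d) +
  \sum_c \sum_d \sum_e Ja c * Jh d * Jb e * D c d e.
Proof.
move=> Gsym; rewrite big_split /=; under eq_bigr do rewrite big_split mulrDl /=.
rewrite big_split /= addrAC; congr (_ + _ + _).
- under eq_bigr do rewrite mulr_suml; rewrite exchange_big; apply: eq_bigr => c _.
  by rewrite mulr_sumr; apply: eq_bigr => d _; rewrite mulrA.
- apply: eq_bigr => c _; rewrite mulrC; congr (_ * _); apply: eq_bigr => d _.
  by rewrite mulrC Gsym.
- under eq_bigr => d _.
    rewrite mulr_suml; under eq_bigr do rewrite mulr_sumr mulr_suml.
    over.
  under [RHS]eq_bigr do rewrite exchange_big.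
  rewrite [RHS]exchange_big; apply: eq_bigr => d _.
  rewrite exchange_big; apply: eq_bigr => e _; apply: eq_bigr => c _.
  by rewrite mulrA (mulrC (Jh _)) mulrAC.
Qed.

(** * Christoffel symbols of a metric in two charts *)

Section Connection.
Context {R : realType} {n : nat} {M : atlas R n} {g : mx_comp M}.
Hypotheses (hM : smooth_manifold M) (hg : riemannian_metric g).
Implicit Types (i j : chart M) (x : M).

Lemma metric_sym i x : dom i x -> (g i x)^T = g i x.
Proof. by case: hg => _ + _; apply. Qed.

Lemma metric_posdef i x : dom i x -> posdef (g i x).
Proof. by move=> ix X X0; case: hg => _ _; apply. Qed.

Lemma metric_transition i j x : dom i x -> dom j x ->
  g i x = tjac i j x *m g j x *m (tjac i j x)^T.
Proof. by case: hg => -[_ tg] _ _ ix jx; rewrite (tg _ _ _ ix jx) !jac_tjac. Qed.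

(** The product rule on the transformation law of [g], followed by the chain rule, which turns
    derivatives of [g j] along chart [i] into derivatives along chart [j]. The shape is the one that
    [christoffel_transition] expects. *)
Lemma partial_metric_transition i j x a h b : dom i x -> dom j x ->
  partial_at i a (fun y => g i y h b) x =
  \sum_c partial_at i a (fun y => tjac i j y h c) x *
     (\sum_d g j x c d * tjac i j x b d) +
  \sum_c partial_at i a (fun y => tjac i j y b c) x *
     (\sum_d g j x c d * tjac i j x h d) +
  \sum_c \sum_d \sum_e tjac i j x a c * tjac i j x h d * tjac i j x b e *
     partial_at j c (fun y => g j y d e) x.
Proof.
move=> ix jx; have dt b' c : differentiable (read i (fun y => tjac i j y b' c)) (coord i x).
  exact: differentiable_tjac.
have dgj c d : differentiable (read j (fun y => g j y c d)) (coord j x).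
  by case: hg => -[sg _] _ _; exact: smooth_in_differentiable.
have dg c d : differentiable (read i (fun y => g j y c d)) (coord i x).
  exact: (differentiable_read hM ix jx).
rewrite (@partial_at_eq _ _ _ hM i j _
  (fun y => \sum_d (\sum_c tjac i j y h c * g j y c d) * tjac i j y b d)) //; last first.
  move=> y iy jy; rewrite (metric_transition iy jy) mxE; apply: eq_bigr => d _.
  by rewrite !mxE.
rewrite partial_at_sum => [|d]; last first.
  apply: differentiable_readM => //; apply: differentiable_read_sum => c.
  exact: differentiable_readM.
have E1 c d : partial_at i a (fun y => tjac i j y h c * g j y c d) x =
    partial_at i a (fun y => tjac i j y h c) x * g j x c d + tjac i j x h c *
    \sum_e tjac i j x a e * partial_at j e (fun y => g j y c d) x.
  by rewrite (partial_atM hM) // -(partial_at_transition hM).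
have E2 d : partial_at i a
      (fun y => (\sum_c tjac i j y h c * g j y c d) * tjac i j y b d) x =
    (\sum_c (partial_at i a (fun y => tjac i j y h c) x * g j x c d + tjac i j x h c *
      \sum_e tjac i j x a e * partial_at j e (fun y => g j y c d) x)) * tjac i j x b d +
    (\sum_c tjac i j x h c * g j x c d) * partial_at i a (fun y => tjac i j y b d) x.
  rewrite (partial_atM hM) //; last first.
    by apply: differentiable_read_sum => c; exact: differentiable_readM.
  rewrite partial_at_sum => [|c]; last exact: differentiable_readM.
  by under eq_bigr do rewrite E1.
rewrite (eq_bigr _ (fun d _ => E2 d)).
apply: (@conj_product_rule _ _ (g j x)
  (fun e c d => partial_at j e (fun y => g j y c d) x)) => c d.
by rewrite -[in LHS](metric_sym jx) mxE.
Qed.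

(** Contracting the upper index with a covector, of components [p] in chart [j], removes the inverse
    Jacobian from the classical law; the inhomogeneous term becomes [p] paired with the second
    derivatives of the coordinates of [j]. *)
Lemma christoffel_law i j x (p : 'rV[R]_n) a b : dom i x -> dom j x ->
  \sum_k (p *m (tjac i j x)^T) 0 k * christoffel g i x k a b =
  (tjac i j x *m (\matrix_(d, e) \sum_k p 0 k * christoffel g j x k d e)
     *m (tjac i j x)^T) a b +
  \sum_c p 0 c * partial_at i a (fun y => tjac i j y b c) x.
Proof.
move=> ix jx.
have uJ : tjac i j x \in unitmx by exact: tjac_unit.
have uG : g j x \in unitmx by exact/posdef_unit/metric_posdef.
have Tsym c d e : partial_at i c (fun y => tjac i j y d e) x =
                  partial_at i d (fun y => tjac i j y c e) x.
  exact: partial_tjacC.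
have Gsym c d : g j x c d = g j x d c by rewrite -[in LHS](metric_sym jx) mxE.
have DE y z w := partial_metric_transition y z w ix jx.
have two0 : (2 : R) != 0 by rewrite pnatr_eq0.
have := christoffel_transition p two0 uJ uG Tsym Gsym DE a b.
by rewrite -metric_transition // [LHS]mxE.
Qed.

Lemma christoffelC i x k a b : dom i x -> christoffel g i x k a b = christoffel g i x k b a.
Proof.
move=> ix; congr (_ * _); apply: eq_bigr => h _; congr (_ * _).
have gC c d e : partial_at i e (fun y => g i y c d) x = partial_at i e (fun y => g i y d c) x.
  apply: (@partial_at_eq _ _ _ hM i i) => // y iy _.
  by rewrite -[in LHS](metric_sym iy) mxE.
by rewrite (gC a b) (gC h b) (gC a h) [X in X - _]addrC.
Qed.

End Connection.

(** * The cotangent bundle without its zero section *)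

Lemma open_continuous_in (T U : topologicalType) (D : set T) (f : T -> U) (P : set U) :
  open D -> (forall u, D u -> {for u, continuous f}) -> open P ->
  open (D `&` f @^-1` P).
Proof.
move=> oD cf oP; rewrite openE => u [Du Pfu].
apply: filterI; first exact: open_nbhs_nbhs.
by apply: cf => //; exact: open_nbhs_nbhs.
Qed.

Section CotangentPoints.
Context {R : realType} {n : nat} {M : atlas R n}.
Hypothesis hM : smooth_manifold M.
Implicit Types (i j : chart M) (z : cotangent0 M).

Lemma covec_transition i j z : dom i (base z) -> dom j (base z) ->
  covec z i = covec z j *m (tjac i j (base z))^T.
Proof. by case: z => x p /= pE _ _ ix jx; rewrite (pE i j) // jac_tjac. Qed.

(** The record provides some chart with nonzero components. The convention of value 0 forces that
    chart to contain the base point, and the transformation law then carries nonvanishing to chart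
    [i]. *)
Lemma covec_neq0 i z : dom i (base z) -> covec z i != 0.
Proof.
move=> iz; apply/eqP => p0; case: z iz p0 => x p pE pout [j pj] /= ix p0.
apply: pj; have [jx|/pout//] := pselect (dom j x).
by rewrite (pE j i) // p0 mul0mx.
Qed.

(** One chart around the base point determines the components in all charts, by the transformation
    law or by the convention of value 0; the proof fields agree by proof irrelevance. *)
Lemma cotangent0_eq i z z' : dom i (base z) -> base z = base z' ->
  covec z i = covec z' i -> z = z'.
Proof.
move=> iz zz' pp'.
have cc' : covec z = covec z'.
  apply/funext => j; have [jz|njz] := pselect (dom j (base z)).
    by rewrite (@covec_transition j i) // (@covec_transition j i z') -?zz' // pp'.
  case: z iz zz' pp' njz => x p /= _ pout _ _ xz' _ njx; rewrite pout //.
  case: z' xz' => x' p' /= _ pout' _ xx'; rewrite pout' // -xx'; exact: njx.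
case: z z' zz' cc' {iz pp'} => x p h1 h2 h3 [x' p' h1' h2' h3'] /= zz' cc'.
subst x' p'.
by congr Cotangent0; exact: Prop_irrelevance.
Qed.

(** The components in chart [i] are transported to every other chart around [x]; the cocycle
    identity [tjac_comp] makes the resulting family consistent. *)
Lemma exists_covector i x (p : 'rV[R]_n) : dom i x -> p != 0 ->
  exists z, base z = x /\ covec z i = p.
Proof.
move=> ix p0.
pose c j := if pselect (dom j x) then p *m (tjac j i x)^T else 0.
have cE j : dom j x -> c j = p *m (tjac j i x)^T.
  by rewrite /c; case: pselect.
have ci : c i = p by rewrite cE // (tjac_id hM) // trmx1 mulmx1.
have h1 j k : dom j x -> dom k x -> c j = c k *m (jac j k x)^T.
  move=> jx kx; rewrite jac_tjac !cE // -mulmxA -trmx_mul.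
  by rewrite (tjac_comp hM).
have h2 j : ~ dom j x -> c j = 0 by rewrite /c; case: pselect.
have h3 : exists j, c j <> 0 by exists i; rewrite ci; exact/eqP.
by exists (Cotangent0 h1 h2 h3).
Qed.

Definition punctured (D : set 'rV[R]_n) : set 'rV[R]_(n + n) :=
  [set u | D (lsubmx u) /\ rsubmx u != 0].

Lemma open_punctured D : open D -> open (punctured D).
Proof.
move=> oD; have -> : punctured D =
    (lsubmx @^-1` D : set 'rV[R]_(n + n)) `&`
    (rsubmx @^-1` [set p | p != 0] : set 'rV[R]_(n + n)) by [].
apply: openI; first exact: open_lsubmx.
apply: open_comp; first by move=> u _; exact: continuous_rsubmx.
have -> : [set p : 'rV[R]_n | p != 0] = ~` [set 0].
  by apply/seteqP; split => p /= /eqP.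
exact/closed_openC/accessible_closed_set1/hausdorff_accessible/norm_hausdorff.
Qed.

(** Every nonzero [p] is reached, by [exists_covector]. With [S] a chart domain this describes
    overlaps, with [setT] the whole chart image, and with [S] open it shows that preimages under
    [base] are open. *)
Lemma image_cotangent i (S : set M) :
  image_in (i : chart (cotangent0_atlas M)) (@base _ _ M @^-1` S) = punctured (image_in i S).
Proof.
apply/seteqP; split => [_ [z [iz Sz] <-]|u [[x [ix Sx] xu] p0]].
  rewrite /punctured /= row_mxKl row_mxKr covec_neq0 //; split=> //.
  by exists (base z).
have [z [zx zp]] := exists_covector ix p0.
exists z => /=; first by rewrite zx.
by rewrite zx zp xu hsubmxK.
Qed.

Lemma coord_cotangent_injective i z z' : dom i (base z) -> dom i (base z') ->
  coord (i : chart (cotangent0_atlas M)) z = coord (i : chart (cotangent0_atlas M)) z' ->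
  z = z'.
Proof.
move=> iz iz' /eq_row_mx[/(coord_injective hM iz iz') zz' pp'].
exact: (cotangent0_eq iz).
Qed.

Lemma read_cotangent (V : zmodType) i (f : cotangent0 M -> V) z : dom i (base z) ->
  read (i : chart (cotangent0_atlas M)) f (row_mx (coord i (base z)) (covec z i)) = f z.
Proof.
move=> iz; apply: (@read_injective _ _ (cotangent0_atlas M) _ i f z) => // z' iz'.
exact: coord_cotangent_injective.
Qed.

(** The change of induced charts as an explicit formula in the coordinates (q, p). It is total, but
    describes the transition only over the overlap of the base charts. *)
Definition cotangent_transition i j (u : 'rV[R]_(n + n)) : 'rV[R]_(n + n) :=
  row_mx (read i (coord j) (lsubmx u))
         (rsubmx u *m (read i (tjac j i) (lsubmx u))^T).

Lemma cotangent_transitionE i j z : dom i (base z) -> dom j (base z) ->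
  cotangent_transition i j (row_mx (coord i (base z)) (covec z i)) =
  row_mx (coord j (base z)) (covec z j).
Proof.
move=> iz jz; rewrite /cotangent_transition row_mxKl row_mxKr !(read_coord hM) //.
by rewrite -covec_transition.
Qed.

Lemma smooth_punctured (D : set 'rV[R]_n) (f : 'rV[R]_n -> R) : open D ->
  smooth_on D f -> smooth_on (punctured D) (fun u => f (lsubmx u)).
Proof.
move=> oD sf; apply: (@smooth_on_sub _ _ (lsubmx @^-1` D)); first by move=> u [].
exact: smooth_on_lsubmx.
Qed.

Lemma smooth_rsubmx (D : set 'rV[R]_(n + n)) :
  smooth_mx D (rsubmx : 'rV[R]_(n + n) -> 'rV[R]_n).
Proof.
move=> a b; rewrite ord1; under eq_fun do rewrite mxE; exact: smooth_on_coord.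
Qed.

Lemma smooth_covec_transition i j :
  smooth_mx (punctured (image_in i (dom j)))
    (fun u => rsubmx u *m (read i (tjac j i) (lsubmx u))^T).
Proof.
have oD := @open_overlap _ _ _ hM i j; have oW := open_punctured oD.
apply: smooth_mxM => //; first exact: smooth_rsubmx.
apply: smooth_mx_tr => // a b.
apply: (@smooth_punctured _ (fun q => read i (tjac j i) q a b)) => //.
exact: (smooth_tjac_inv hM).
Qed.

Lemma smooth_cotangent_transition i j a :
  smooth_on (punctured (image_in i (dom j))) (fun u => cotangent_transition i j u 0 a).
Proof.
have oD := @open_overlap _ _ _ hM i j.
case: (split_ordP a) => b ->.
  under eq_fun do rewrite row_mxEl.
  apply: (@smooth_punctured _ (fun q => read i (coord j) q 0 b)) => //.
  exact: (smooth_transition hM).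
under eq_fun do rewrite row_mxEr; exact: smooth_covec_transition.
Qed.

Lemma open_set_base (S : set M) : open_set S ->
  open_set (N := cotangent0_atlas M) (@base _ _ M @^-1` S).
Proof. by move=> oS i; rewrite image_cotangent; exact: open_punctured. Qed.

(** In any chart [j] the components with respect to [i] are a continuous function of (q, p) over the
    overlap. These sets separate distinct covectors in one fibre. *)
Lemma open_set_covec i (P : set 'rV[R]_n) : open P ->
  open_set (N := cotangent0_atlas M) [set z | dom i (base z) /\ P (covec z i)].
Proof.
move=> oP j; change (chart M) in j.
pose f u := rsubmx u *m (read j (tjac i j) (lsubmx u))^T.
have -> : image_in (N := cotangent0_atlas M) j [set z | dom i (base z) /\ P (covec z i)] =
    punctured (image_in j (dom i)) `&` f @^-1` P.
  rewrite -image_cotangent.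
  have fE z : dom j (base z) -> dom i (base z) ->
      f (row_mx (coord j (base z)) (covec z j)) = covec z i.
    move=> jz iz; rewrite /f row_mxKl row_mxKr (read_coord hM) //.
    by rewrite -covec_transition.
  apply/seteqP; split => [_ [z [jz [iz Pz]] <-]|_ [[z [jz iz] <-]]].
    by split; [exists z|rewrite /= fE].
  by rewrite /= fE // => Pz; exists z.
apply: (@open_continuous_in _ _ _ f _ _ _ oP).
  exact/open_punctured/(open_overlap hM).
move=> u Du; apply: differentiable_continuous; apply: differentiable_rowP => b.
exact: smooth_on_differentiable (@smooth_covec_transition j i 0 b) Du.
Qed.

Lemma cotangent0_smooth_manifold : smooth_manifold (cotangent0_atlas M).
Proof.
split.
- by move=> i z z'; rewrite !inE; exact: coord_cotangent_injective.
- have E (i j : chart M) :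
      image_in (N := cotangent0_atlas M) i (dom (a := cotangent0_atlas M) j) =
      punctured (image_in i (dom j)) by exact: image_cotangent.
  split=> [i j|i j a]; rewrite E; first exact/open_punctured/(open_overlap hM).
  change (chart M) in i; change (chart M) in j.
  apply: (@smooth_on_eq _ _ _ (fun u => cotangent_transition i j u 0 a)).
  + exact/open_punctured/(open_overlap hM).
  + rewrite -E => _ [z [iz jz] <-] /=.
    by rewrite read_cotangent // cotangent_transitionE.
  + exact: smooth_cotangent_transition.
(* Separation: two covectors over one point are separated by their components in a common chart, two
   covectors over different points by preimages of open sets of the base. *)
- move=> z z' zz'; have [bb'|bb'] := pselect (base z = base z').
    have [i iz] := exists_chart hM (base z).
    have pp' : covec z i != covec z' i.
      by apply/eqP => pp'; apply: zz'; exact: (cotangent0_eq iz).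
    have := @norm_hausdorff _ 'rV[R]_n; rewrite open_hausdorff.
    move=> /(_ _ _ pp')[[P P'] /= [/set_mem Pz /set_mem Pz'] [oP oP' /eqP PP']].
    exists [set z | dom i (base z) /\ P (covec z i)],
           [set z | dom i (base z) /\ P' (covec z i)]; split.
    + exact: open_set_covec.
    + exact: open_set_covec.
    + by [].
    + by rewrite /= -bb'.
    + rewrite -subset0 => w [[_ Pw] [_ Pw']].
      by have : (P `&` P') (covec w i) by []; rewrite PP'.
  have [_ _ H _] := hM; have [S [T [oS oT Sx Ty ST]]] := H _ _ bb'.
  exists (@base _ _ M @^-1` S), (@base _ _ M @^-1` T); split => //.
  + exact: open_set_base.
  + exact: open_set_base.
  + by rewrite -preimage_setI ST preimage_set0.
- by have [_ _ _ [C [cC HC]]] := hM; exists C; split => // z; exact: HC.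
Qed.

End CotangentPoints.

(** * The lifted metric and almost complex structure *)

Section BlockAlgebra.
Context {F : fieldType} {n : nat}.
Implicit Types (S G J K : 'M[F]_n).

(** [S] plays the part of Gamma^0; [diag G] and [quarter G] are the lifted metric and almost complex
    structure in the adapted frame, and [omega] is the fundamental form. *)
Local Notation cofr S := (block_mx 1%:M (- S^T) 0 1%:M).
Local Notation fr S := (block_mx 1%:M S 0 1%:M).
Local Notation quarter G := (block_mx 0 G (- invmx G) 0).
Local Notation diag G := (block_mx G 0 0 (invmx G)).
Local Notation omega := (block_mx 0 (- 1%:M) 1%:M 0 : 'M[F]_(n + n)).

Lemma frame_coframe S : S^T = S -> fr S *m cofr S = 1%:M.
Proof.
move=> ->; rewrite mulmx_block !mulmx1 !mul1mx !mulmx0 !mul0mx !add0r addr0 addNr.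
by rewrite -scalar_mx_block.
Qed.

Lemma coframe_frame S : S^T = S -> cofr S *m fr S = 1%:M.
Proof. by move/frame_coframe/mulmx1C. Qed.

Lemma quarter_square G : G \in unitmx -> quarter G *m quarter G = - 1%:M.
Proof.
move=> uG; rewrite mulmx_block !mulmx0 !mul0mx !addr0 !add0r mulmxN mulNmx.
by rewrite mulmxV // mulVmx // scalar_mx_block opp_block_mx oppr0.
Qed.

Lemma quarter_conj G : G^T = G -> G \in unitmx ->
  quarter G *m diag G *m (quarter G)^T = diag G.
Proof.
move=> Gsym uG; rewrite tr_block_mx !trmx0 linearN /= trmx_inv Gsym !mulmx_block.
rewrite !mulmx0 !mul0mx !addr0 !add0r mulmxV // mulNmx mulVmx // !mul1mx.
by rewrite mulNmx mulmxN mul1mx opprK !mul0mx oppr0.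
Qed.

Lemma diag_quarter G : G^T = G -> G \in unitmx -> diag G *m (quarter G)^T = omega.
Proof.
move=> Gsym uG; rewrite tr_block_mx !trmx0 linearN /= trmx_inv Gsym !mulmx_block.
by rewrite !mulmx0 !mul0mx !addr0 !add0r mulmxN mulmxV // mulVmx.
Qed.

(** A shear is symplectic when its block is symmetric: the only new block of the conjugate is
    [S - S^T]. The absence of torsion enters here. *)
Lemma coframe_omega S : S^T = S -> cofr S *m omega *m (cofr S)^T = omega.
Proof.
move=> Ssym; rewrite tr_block_mx !trmx0 !trmx1 linearN /= trmxK Ssym !mulmx_block.
by rewrite !(mulmx0, mul0mx, mulmx1, mul1mx, mulmxN, mulNmx, opprK, oppr0, addr0, add0r, subrr, addNr).
Qed.

(** Here [J] is the Jacobian of a change of base chart, not the almost complex structure, [K] is its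
    inverse and [Jac] the Jacobian of the induced charts. [JacE] expresses that the splitting into
    horizontal and vertical parts does not depend on the chart. *)
Variables (S S' G G' J K : 'M[F]_n) (Jac : 'M[F]_(n + n)).
Hypotheses (Ssym : S^T = S) (S'sym : S'^T = S') (JK : J *m K = 1%:M).
Hypotheses (Gsym : G^T = G) (uG : G \in unitmx) (uG' : G' \in unitmx).
Hypothesis GE : G = J *m G' *m J^T.
Hypothesis JacE : Jac *m cofr S' = cofr S *m block_mx J 0 0 K^T.

Lemma invmx_transition : invmx G = K^T *m invmx G' *m K.
Proof.
apply: (can_inj (mulKmx uG)); rewrite mulmxV // GE -!mulmxA (mulmxA J^T).
by rewrite -trmx_mul (mulmx1C JK) trmx1 mul1mx (mulmxA G') mulmxV // mul1mx.
Qed.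

Lemma diag_transition :
  diag G = block_mx J 0 0 K^T *m diag G' *m (block_mx J 0 0 K^T)^T.
Proof.
rewrite invmx_transition tr_block_mx !trmx0 trmxK !mulmx_block.
by rewrite !(mulmx0, mul0mx, addr0, add0r) -GE.
Qed.

Lemma quarter_transition :
  quarter G *m block_mx J 0 0 K^T = block_mx J 0 0 K^T *m quarter G'.
Proof.
have KJ := mulmx1C JK.
rewrite invmx_transition !mulmx_block !mulmx0 !mul0mx !addr0 !add0r; congr block_mx.
  by rewrite GE -!mulmxA -trmx_mul KJ trmx1 mulmx1.
by rewrite mulNmx mulmxN -!mulmxA KJ mulmx1.
Qed.

Lemma metric_block_transition :
  cofr S *m diag G *m (cofr S)^T =
  Jac *m (cofr S' *m diag G' *m (cofr S')^T) *m Jac^T.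
Proof. by rewrite diag_transition !mulmxA JacE -!mulmxA -!trmx_mul JacE !mulmxA. Qed.

Lemma endomorphism_block_transition :
  cofr S *m quarter G *m fr S *m Jac = Jac *m (cofr S' *m quarter G' *m fr S').
Proof.
have FJac : fr S *m Jac = block_mx J 0 0 K^T *m fr S'.
  rewrite -[Jac]mulmx1 -(coframe_frame S'sym) (mulmxA Jac) JacE !mulmxA.
  by rewrite frame_coframe // mul1mx.
have -> : Jac *m (cofr S' *m quarter G' *m fr S') =
    cofr S *m (quarter G *m block_mx J 0 0 K^T) *m fr S'.
  by rewrite quarter_transition !mulmxA JacE.
by rewrite -(mulmxA _ (fr S)) FJac !mulmxA.
Qed.

End BlockAlgebra.

(** * The Jacobian of a change of induced charts *)

Section CotangentJacobian.
Context {R : realType} {n : nat} {M : atlas R n}.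
Hypothesis hM : smooth_manifold M.
Implicit Types (i j : chart M) (z : cotangent0 M).

Let hCM : smooth_manifold (cotangent0_atlas M) := cotangent0_smooth_manifold hM.

Lemma partial_at_cst i x a (c : R) : dom i x -> partial_at i a (fun=> c) x = 0.
Proof.
move=> ix; rewrite /partial_at (@partial_near _ _ _ _ (fun=> c)) ?partial_cst //.
apply: (@open_near_eq _ _ (image_in i setT)).
- exact: open_image.
- exact: image_in_coord.
- by move=> _ [y [iy _] <-]; rewrite (read_coord hM).
Qed.

(* Differentiate [J K = 1], where [K] is the inverse of the Jacobian [J]. *)
Lemma partial_tjac_inv i j x a b c : dom i x -> dom j x ->
  \sum_d tjac i j x b d * partial_at i a (fun y => tjac j i y d c) x =
  - \sum_d partial_at i a (fun y => tjac i j y b d) x * tjac j i x d c.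
Proof.
move=> ix jx; apply/eqP; rewrite -addr_eq0 addrC -big_split /=; apply/eqP.
have dJ e d : differentiable (read i (fun y => tjac i j y e d)) (coord i x).
  exact: differentiable_tjac.
have dK e d : differentiable (read i (fun y => tjac j i y e d)) (coord i x).
  exact: (differentiable_read hM ix jx (differentiable_tjac hM e d jx ix)).
under eq_bigr do rewrite -(partial_atM hM) //.
rewrite -partial_at_sum => [|d]; last exact: differentiable_readM.
transitivity (partial_at i a (fun=> (b == c)%:R : R) x); last exact: partial_at_cst.
apply: (@partial_at_eq _ _ _ hM i j) => // y iy jy.
by have /matrixP/(_ b c) := tjacK hM iy jy; rewrite !mxE.
Qed.

(** The derivatives of the new fibre coordinates along the old base coordinates, the old fibre
    coordinates being fixed. *)
Definition fibre_block i j z : 'M[R]_n := \matrix_(a, b)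
  \sum_c covec z i 0 c * partial_at i a (fun y => tjac j i y b c) (base z).

(** Differentiation of [cotangent_transition]: its base part depends on q alone, whence the zero
    block, and its fibre part is linear in p with coefficients depending on q. *)
Lemma tjac_cotangent i j z : dom i (base z) -> dom j (base z) ->
  tjac (N := cotangent0_atlas M) i j z =
  block_mx (tjac i j (base z)) (fibre_block i j z) 0 (tjac j i (base z))^T.
Proof.
move=> iz jz; set x := base z; set p := covec z i.
pose u : 'rV[R]_(n + n) := row_mx (coord i x) p.
have lu : lsubmx u = coord i x by rewrite row_mxKl.
have ru c : u 0 (rshift n c) = p 0 c by rewrite row_mxEr.
have uD : punctured (image_in i (dom j)) u.
  rewrite /punctured /= lu row_mxKr covec_neq0 //; split=> //.
  exact: image_in_coord.
have dK b c : differentiable (read i (fun y => tjac j i y b c)) (coord i x).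
  exact: (differentiable_read hM iz jz (differentiable_tjac hM b c jz iz)).
have dl (f : 'rV[R]_n -> R) : differentiable f (coord i x) ->
    differentiable (fun w : 'rV[R]_(n + n) => f (lsubmx w)) u.
  move=> df; apply: (@differentiable_comp _ _ _ _ lsubmx f).
    exact: differentiable_lsubmx.
  by rewrite lu.
have dp c : differentiable (fun w : 'rV[R]_(n + n) => w 0 (rshift n c)) u.
  exact: differentiable_coord.
have E (a b : 'I_(n + n)) : tjac (N := cotangent0_atlas M) i j z a b =
    partial a (fun w => cotangent_transition i j w 0 b) u.
  rewrite (tjac_partial hCM) //; apply: partial_near.
  apply: (@open_near_eq _ _ (punctured (image_in i (dom j)))) => //.
    exact/open_punctured/open_overlap.
  move=> w; rewrite -image_cotangent // => -[z' [iz' jz'] <-].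
  by rewrite read_cotangent // cotangent_transitionE.
have Er b : (fun w => cotangent_transition i j w 0 (rshift n b)) =
    fun w => \sum_c w 0 (rshift n c) * read i (fun y => tjac j i y b c) (lsubmx w).
  apply/funext => w; rewrite row_mxEr mxE; apply: eq_bigr => c _.
  by rewrite !mxE read_mxE.
have dpK b c : differentiable (fun w : 'rV[R]_(n + n) =>
    w 0 (rshift n c) * read i (fun y => tjac j i y b c) (lsubmx w)) u.
  by apply: differentiableM => //; exact: dl.
have El b : (fun w => cotangent_transition i j w 0 (lshift n b)) =
    (fun q => read i (coord j) q 0 b) \o lsubmx.
  by apply/funext => w; rewrite row_mxEl.
have dq b : differentiable (fun q => read i (coord j) q 0 b) (lsubmx u).
  rewrite lu; apply: (smooth_on_differentiable (smooth_transition hM i j b)).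
  exact: image_in_coord.
apply/matrixP => a b; rewrite E.
case: (split_ordP a) => a' ->; case: (split_ordP b) => b' ->.
- by rewrite El partial_lsubmx // lu block_mxEul (tjac_partial hM).
- rewrite Er block_mxEur mxE partial_sum //; apply: eq_bigr => c _.
  rewrite partialM //; last exact: dl.
  rewrite partial_coord eq_rlshift mul0r add0r ru.
  by rewrite partial_lsubmx lu.
- by rewrite El partial_lsubmx0 // block_mxEdl mxE.
- rewrite Er block_mxEdr mxE partial_sum // (bigD1 a') //=.
  rewrite partialM //; last exact: dl.
  rewrite partial_coord eqxx mul1r partial_lsubmx0 ?lu // mulr0 addr0.
  rewrite (read_coord hM) // big1 ?addr0 // => c ca.
  rewrite partialM //; last exact: dl.
  rewrite partial_coord (inj_eq (@rshift_inj _ _)) (negbTE ca) mul0r.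
  by rewrite partial_lsubmx0 ?lu // mulr0 addr0.
Qed.

End CotangentJacobian.

(** * Chart independence of the lifted tensors *)

Section LiftedStructure.
Context {R : realType} {n : nat} {M : atlas R n} {g : mx_comp M} {A : R} {v : R -> R}.
Hypotheses (hM : smooth_manifold M) (hg : riemannian_metric g).
Hypotheses (hA : 0 < A) (hv : smooth_on_pos v)
  (hAv : forall t : R, 0 < t -> 0 < A + 2 * v t).
Implicit Types (i j : chart M) (z : cotangent0 M).

Let hCM : smooth_manifold (cotangent0_atlas M) := cotangent0_smooth_manifold hM.

Lemma Gamma0_sym i z : dom i (base z) -> (Gamma0 g i z)^T = Gamma0 g i z.
Proof.
move=> iz; apply/matrixP => a b; rewrite !mxE; apply: eq_bigr => k _.
by rewrite (christoffelC hM hg).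
Qed.

(** Multiplication by the transposed Jacobian trades the derivatives of the inverse Jacobian for
    second derivatives of the coordinates of [j], by [partial_tjac_inv]; the leftover inverse
    Jacobian converts the components of the covector from [i] to [j]. *)
Lemma lowered_fibre_block i j z a d : dom i (base z) -> dom j (base z) ->
  (fibre_block i j z *m (tjac i j (base z))^T) a d =
    - \sum_c covec z j 0 c * partial_at i a (fun y => tjac i j y d c) (base z).
Proof.
move=> iz jz.
transitivity (\sum_c covec z i 0 c * \sum_b tjac i j (base z) d b *
    partial_at i a (fun y => tjac j i y b c) (base z)).
  rewrite mxE; under eq_bigr do rewrite !mxE mulr_suml.
  rewrite exchange_big; apply: eq_bigr => c _; rewrite mulr_sumr.
  by apply: eq_bigr => b _; rewrite -mulrA (mulrC (partial_at _ _ _ _)).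
under eq_bigr do rewrite partial_tjac_inv // mulrN mulr_sumr.
rewrite sumrN exchange_big; congr (- _); apply: eq_bigr => b _.
rewrite (covec_transition (i := j) (j := i)) // mxE mulr_suml.
by apply: eq_bigr => c _; rewrite mxE -[RHS]mulrA; congr (_ * _); rewrite mulrC.
Qed.

(** After multiplication by the invertible transposed Jacobian, the left side is minus the
    inhomogeneous term of [christoffel_law], and the right side is minus the same term by that
    law. *)
Lemma fibre_block_Gamma0 i j z : dom i (base z) -> dom j (base z) ->
  fibre_block i j z = tjac i j (base z) *m Gamma0 g j z -
    Gamma0 g i z *m (tjac j i (base z))^T.
Proof.
move=> iz jz; have JK := tjacK hM iz jz.
have KJT : (tjac i j (base z))^T *m (tjac j i (base z))^T = 1%:M.
  by rewrite -trmx_mul (mulmx1C JK) trmx1.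
have [uJ _] := mulmx1_unit KJT.
apply: (can_inj (mulmxK uJ)); rewrite mulmxBl -(mulmxA (Gamma0 _ _ _)).
rewrite (mulmx1C KJT) mulmx1; apply/matrixP => a d.
rewrite lowered_fibre_block // [RHS]mxE [X in _ = _ + X]mxE [Gamma0 g i z a d]mxE.
rewrite (covec_transition (i := i) (j := j)) // (christoffel_law hM hg) //.
by rewrite opprD addNKr.
Qed.

Lemma coframe_transition i j z : dom i (base z) -> dom j (base z) ->
  tjac (N := cotangent0_atlas M) i j z *m coframe g j z =
  coframe g i z *m block_mx (tjac i j (base z)) 0 0 (tjac j i (base z))^T.
Proof.
move=> iz jz; rewrite (tjac_cotangent hM) // /coframe !mulmx_block !Gamma0_sym //.
rewrite !(mulmx0, mul0mx, mulmx1, mul1mx, addr0, add0r, mulmxN, mulNmx).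
by rewrite fibre_block_Gamma0 // addrA addNr add0r.
Qed.

Lemma energy_gt0 i z : dom i (base z) -> 0 < energy g i z.
Proof.
move=> iz; apply: mulr_gt0 => //; apply: posdef_inv; last exact: covec_neq0.
  exact: metric_sym.
exact: metric_posdef.
Qed.

Lemma Gmx_sym i z : dom i (base z) -> (Gmx g A v i z)^T = Gmx g A v i z.
Proof.
move=> iz; rewrite /Gmx linearD /= !linearZ /= trmx_mul trmxK.
by rewrite (metric_sym hg).
Qed.

Lemma Gmx_posdef i z : dom i (base z) -> posdef (Gmx g A v i z).
Proof.
move=> iz; apply: posdef_rank_one => //.
- exact: metric_sym.
- exact: metric_posdef.
- exact: covec_neq0.
- exact/hAv/energy_gt0.
Qed.

Lemma Gmx_unit i z : dom i (base z) -> Gmx g A v i z \in unitmx.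
Proof. by move=> iz; exact/posdef_unit/Gmx_posdef. Qed.

Lemma energy_transition i j z : dom i (base z) -> dom j (base z) ->
  energy g i z = energy g j z.
Proof.
move=> iz jz; rewrite /energy (covec_transition (i := i) (j := j)) //.
rewrite (invmx_transition (tjacK hM iz jz) _ _ (metric_transition hg iz jz)); first last.
- exact/posdef_unit/metric_posdef.
- exact/posdef_unit/metric_posdef.
rewrite trmx_mul trmxK !mulmxA -(mulmxA _ (_^T) (_^T)) -trmx_mul.
have KJ := mulmx1C (tjacK hM iz jz).
by rewrite KJ trmx1 mulmx1 -(mulmxA _ (tjac j i _)) KJ mulmx1.
Qed.

Lemma Gmx_transition i j z : dom i (base z) -> dom j (base z) ->
  Gmx g A v i z = tjac i j (base z) *m Gmx g A v j z *m (tjac i j (base z))^T.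
Proof.
move=> iz jz; rewrite /Gmx (energy_transition iz jz) mulmxDr mulmxDl.
rewrite -!scalemxAr -!scalemxAl -(metric_transition hg) //; congr (_ + _ *: _).
by rewrite (covec_transition (i := i) (j := j)) // trmx_mul trmxK !mulmxA.
Qed.

Lemma lift_metric_transition i j z : dom i (base z) -> dom j (base z) ->
  lift_metric g A v i z = jac (N := cotangent0_atlas M) i j z *m lift_metric g A v j z
    *m (jac (N := cotangent0_atlas M) i j z)^T.
Proof.
move=> iz jz; rewrite jac_tjac.
exact: (metric_block_transition (tjacK hM iz jz) (Gmx_unit iz) (Gmx_unit jz)
  (Gmx_transition iz jz) (coframe_transition iz jz)).
Qed.

Lemma lift_J_transition i j z : dom i (base z) -> dom j (base z) ->
  lift_J g A v i z *m jac (N := cotangent0_atlas M) i j z =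
  jac (N := cotangent0_atlas M) i j z *m lift_J g A v j z.
Proof.
move=> iz jz; rewrite jac_tjac.
exact: (endomorphism_block_transition (Gamma0_sym iz) (Gamma0_sym jz)
  (tjacK hM iz jz) (Gmx_unit iz) (Gmx_unit jz)
  (Gmx_transition iz jz) (coframe_transition iz jz)).
Qed.

End LiftedStructure.

(** * Smoothness of the lifted tensors *)

Section LiftSmoothness.
Context {R : realType} {n : nat} {M : atlas R n} {g : mx_comp M} {A : R} {v : R -> R}.
Hypotheses (hM : smooth_manifold M) (hg : riemannian_metric g).
Hypotheses (hA : 0 < A) (hv : smooth_on_pos v)
  (hAv : forall t : R, 0 < t -> 0 < A + 2 * v t).
Variable i : chart M.

Let U : set 'rV[R]_n := image_in i setT.
Let oU : open U := open_image hM (i := i).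
Let W : set 'rV[R]_(n + n) := punctured U.
Let oW : open W := open_punctured oU.

Definition covec_coord z : 'rV[R]_(n + n) := row_mx (coord i (base z)) (covec (N := M) z i).

Lemma punctured_covec_coord u : W u -> exists2 z, dom i (base z) & covec_coord z = u.
Proof.
by rewrite /W /U -[punctured _](image_cotangent hM i setT) => -[z [iz _] <-]; exists z.
Qed.

(** Smoothness in the induced chart, witnessed by some function of (q, p) that need agree with [X]
    only on chart points. Closure under matrix operations then follows by operating on the
    witnesses, without any algebra on [read]. *)
Definition smooth_lift p q (X : cotangent0 M -> 'M[R]_(p, q)) : Prop :=
  exists2 F, smooth_mx W F & forall z, dom i (base z) -> F (covec_coord z) = X z.

Lemma smooth_lift_in p q (X : cotangent0 M -> 'M[R]_(p, q)) a b :
  smooth_lift X -> smooth_in (N := cotangent0_atlas M) i (fun z => X z a b).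
Proof.
move=> [F sF FX]; rewrite /smooth_in [image_in _ _](image_cotangent hM i setT).
apply: (@smooth_on_eq _ _ _ (fun u => F u a b)) => // _ /punctured_covec_coord[z iz <-].
by rewrite FX // (read_cotangent hM).
Qed.

Lemma smooth_lift_base p q (X : M -> 'M[R]_(p, q)) :
  (forall a b, smooth_in i (fun x => X x a b)) -> smooth_lift (fun z => X (base z)).
Proof.
move=> sX; exists (fun u => read i X (lsubmx u)) => [a b|z iz].
  apply: (@smooth_punctured _ _ _ (fun w => read i X w a b)) => //.
  have -> : (fun w => read i X w a b) = read i (fun x => X x a b).
    by apply/funext => w; rewrite read_mxE.
  exact: sX.
by rewrite row_mxKl (read_coord hM).
Qed.

Lemma smooth_lift_covec : smooth_lift (fun z => covec z i).
Proof.
by exists rsubmx; [exact: smooth_rsubmx|move=> z iz; rewrite row_mxKr].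
Qed.

Lemma smooth_lift_cst p q (C : 'M[R]_(p, q)) : smooth_lift (fun=> C).
Proof. by exists (fun=> C) => //; exact: smooth_mx_cst. Qed.

Lemma smooth_liftM p q r (X : cotangent0 M -> 'M[R]_(p, q))
    (Y : cotangent0 M -> 'M[R]_(q, r)) :
  smooth_lift X -> smooth_lift Y -> smooth_lift (fun z => X z *m Y z).
Proof.
move=> [F sF FX] [G sG GY]; exists (fun u => F u *m G u); first exact: smooth_mxM.
by move=> z iz; rewrite FX // GY.
Qed.

Lemma smooth_liftD p q (X Y : cotangent0 M -> 'M[R]_(p, q)) :
  smooth_lift X -> smooth_lift Y -> smooth_lift (fun z => X z + Y z).
Proof.
move=> [F sF FX] [G sG GY]; exists (fun u => F u + G u); first exact: smooth_mxD.
by move=> z iz; rewrite FX // GY.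
Qed.

Lemma smooth_liftN p q (X : cotangent0 M -> 'M[R]_(p, q)) :
  smooth_lift X -> smooth_lift (fun z => - X z).
Proof.
move=> [F sF FX]; exists (fun u => - F u); first exact: smooth_mxN.
by move=> z iz; rewrite FX.
Qed.

Lemma smooth_lift_tr p q (X : cotangent0 M -> 'M[R]_(p, q)) :
  smooth_lift X -> smooth_lift (fun z => (X z)^T).
Proof.
move=> [F sF FX]; exists (fun u => (F u)^T); first exact: smooth_mx_tr.
by move=> z iz; rewrite FX.
Qed.

Lemma smooth_lift_inv p (X : cotangent0 M -> 'M[R]_p) :
  (forall z, dom i (base z) -> X z \in unitmx) ->
  smooth_lift X -> smooth_lift (fun z => invmx (X z)).
Proof.
move=> uX [F sF FX]; exists (fun u => invmx (F u)); last by move=> z iz; rewrite FX.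
by apply: smooth_mx_inv => // _ /punctured_covec_coord[z iz <-]; rewrite FX // uX.
Qed.

Lemma smooth_lift_block p1 p2 q1 q2 (X11 : cotangent0 M -> 'M[R]_(p1, q1))
    (X12 : cotangent0 M -> 'M[R]_(p1, q2)) (X21 : cotangent0 M -> 'M[R]_(p2, q1))
    (X22 : cotangent0 M -> 'M[R]_(p2, q2)) :
  smooth_lift X11 -> smooth_lift X12 -> smooth_lift X21 -> smooth_lift X22 ->
  smooth_lift (fun z => block_mx (X11 z) (X12 z) (X21 z) (X22 z)).
Proof.
move=> [F11 s11 E11] [F12 s12 E12] [F21 s21 E21] [F22 s22 E22].
exists (fun u => block_mx (F11 u) (F12 u) (F21 u) (F22 u)).
  exact: smooth_mx_block.
by move=> z iz; rewrite E11 // E12 // E21 // E22.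
Qed.

(** Scalars are handled as 1 by 1 matrices, so that one predicate covers scalar and matrix
    quantities. *)
Lemma smooth_liftZ p q (f : cotangent0 M -> R) (X : cotangent0 M -> 'M[R]_(p, q)) :
  smooth_lift (fun z => (f z)%:M : 'M[R]_1) ->
  smooth_lift X -> smooth_lift (fun z => f z *: X z).
Proof.
move=> [F sF Ff] [G sG GX]; exists (fun u => F u 0 0 *: G u).
  by apply: smooth_mxZ => //; exact: sF.
by move=> z iz; rewrite Ff // GX // mxE eqxx mulr1n.
Qed.

Lemma smooth_lift_comp1 (w : R -> R) (f : cotangent0 M -> R) :
  smooth_on_pos w -> (forall z, dom i (base z) -> 0 < f z) ->
  smooth_lift (fun z => (f z)%:M : 'M[R]_1) ->
  smooth_lift (fun z => (w (f z))%:M : 'M[R]_1).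
Proof.
move=> sw f0 [F sF Ff].
have FE z : dom i (base z) -> F (covec_coord z) 0 0 = f z.
  by move=> iz; rewrite Ff // mxE eqxx mulr1n.
exists (fun u => (w (F u 0 0))%:M); last by move=> z iz; rewrite FE.
move=> a b; rewrite !ord1; under eq_fun do rewrite mxE eqxx mulr1n.
apply: (@smooth_on_comp1 _ _ w W (fun u => F u 0 0)) => //.
by move=> _ /punctured_covec_coord[z iz <-]; rewrite FE // f0.
Qed.

Lemma smooth_christoffel k a b : smooth_in i (fun x => christoffel g i x k a b).
Proof.
have sg c d : smooth_in i (fun x => g i x c d) by case: hg => -[+ _] _ _; apply.
(* The Christoffel symbol as a function of the coordinates; the difference is written with the
   factor -1 so that closure under sums and products is enough. *)
pose F u : R := 2^-1 * \sum_h invmx (read i (g i) u) k h *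
   (partial a (read i (fun x => g i x h b)) u + partial b (read i (fun x => g i x a h)) u
    + (-1) * partial h (read i (fun x => g i x a b)) u).
have sgm : smooth_mx U (read i (g i)).
  move=> c d; have -> : (fun w => read i (g i) w c d) = read i (fun x => g i x c d).
    by apply/funext => w; rewrite read_mxE.
  exact: sg.
apply: (@smooth_on_eq _ _ _ F) => //.
  move=> _ [x [ix _] <-]; rewrite (read_coord hM) // /F (read_coord hM) //.
  by congr (_ * _); apply: eq_bigr => h _; rewrite mulN1r.
have s1 c : smooth_on U (fun=> c : R) by exact: smooth_on_cst.
have sp c d e : smooth_on U (partial c (read i (fun x => g i x d e))).
  by apply: smooth_on_partial; exact: sg.
apply: smooth_onM => //; apply: smooth_on_sum => // h _; apply: smooth_onM => //.
  apply: (@smooth_mx_inv _ _ U oU _ (read i (g i))) => // _ [x [ix _] <-].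
  by rewrite (read_coord hM) //; exact/posdef_unit/metric_posdef.
apply: smooth_onD => //; first exact: smooth_onD.
exact: smooth_onM.
Qed.

Lemma smooth_lift_Gamma0 : smooth_lift (Gamma0 g i).
Proof.
have [P sP PE] := smooth_lift_covec.
have sc k := @smooth_lift_base _ _ (fun x => \matrix_(a < n, b < n) christoffel g i x k a b).
have {}sc k : smooth_lift (fun z => \matrix_(a < n, b < n) christoffel g i (base z) k a b).
  by apply: sc => a b; under eq_fun do rewrite mxE; exact: smooth_christoffel.
have sk k : smooth_lift (fun z => covec z i 0 k *:
    \matrix_(a < n, b < n) christoffel g i (base z) k a b).
  apply: smooth_liftZ => //; exists (fun u => (P u 0 k)%:M); last by move=> z iz; rewrite PE.
  by move=> a b; rewrite !ord1; under eq_fun do rewrite mxE eqxx mulr1n; exact: sP.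
have {sk} : forall k, exists F : 'rV[R]_(n + n) -> 'M[R]_n, smooth_mx W F /\
    forall z, dom i (base z) -> F (covec_coord z) = covec z i 0 k *:
    \matrix_(a < n, b < n) christoffel g i (base z) k a b.
  by move=> k; have [F ? ?] := sk k; exists F.
(* Witnesses for all [k] are chosen simultaneously, so that their sum is a single witness for the
   contraction with p. *)
move=> /choice[F FP]; exists (fun u => \sum_k F k u).
  move=> a b; under eq_fun do rewrite summxE.
  by apply: smooth_on_sum => // k _; have [+ _] := FP k; apply.
move=> z iz; apply/matrixP => a b; rewrite mxE summxE; apply: eq_bigr => k _.
by have [_ ->] := FP k; rewrite // !mxE.
Qed.

Lemma smooth_lift_metric_base : smooth_lift (fun z => g i (base z)).
Proof. by apply: smooth_lift_base => a b; case: hg => -[+ _] _ _; apply. Qed.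

Lemma smooth_lift_energy : smooth_lift (fun z => (energy g i z)%:M : 'M[R]_1).
Proof.
have : smooth_lift (fun z => covec z i *m invmx (g i (base z)) *m (covec z i)^T).
  apply: smooth_liftM; last exact/smooth_lift_tr/smooth_lift_covec.
  apply: smooth_liftM; first exact: smooth_lift_covec.
  apply: smooth_lift_inv; last exact: smooth_lift_metric_base.
  by move=> z iz; exact/posdef_unit/metric_posdef.
have : smooth_lift (fun=> (2^-1)%:M : 'M[R]_1) by exact: smooth_lift_cst.
move=> /smooth_liftM H /H [F sF FE]; exists F => // z iz.
by rewrite FE // mul_scalar_mx [X in _ *: X]mx11_scalar scale_scalar_mx.
Qed.

Lemma smooth_lift_Gmx : smooth_lift (Gmx g A v i).
Proof.
apply: smooth_liftD; apply: smooth_liftZ.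
- have : smooth_lift (fun=> A%:M : 'M[R]_1) by exact: smooth_lift_cst.
  move=> /smooth_liftM/(_ smooth_lift_energy)[F sF FE]; exists F => // z iz.
  by rewrite FE // -scalar_mxM.
- exact: smooth_lift_metric_base.
- apply: smooth_lift_comp1 => //; last exact: smooth_lift_energy.
  by move=> z iz; exact: (energy_gt0 hg).
- apply: smooth_liftM; last exact: smooth_lift_covec.
  exact/smooth_lift_tr/smooth_lift_covec.
Qed.

Lemma smooth_lift_Hmx : smooth_lift (Hmx g A v i).
Proof.
apply: smooth_lift_inv; last exact: smooth_lift_Gmx.
by move=> z iz; exact: (Gmx_unit hg).
Qed.

Lemma smooth_lift_coframe : smooth_lift (coframe g i).
Proof.
apply: smooth_lift_block; try exact: smooth_lift_cst.
exact/smooth_liftN/smooth_lift_tr/smooth_lift_Gamma0.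
Qed.

Lemma smooth_lift_frame : smooth_lift (frame g i).
Proof.
apply: smooth_lift_block; try exact: smooth_lift_cst.
exact: smooth_lift_Gamma0.
Qed.

Lemma smooth_lift_lift_metric : smooth_lift (lift_metric g A v i).
Proof.
apply: smooth_liftM; last exact/smooth_lift_tr/smooth_lift_coframe.
apply: smooth_liftM; first exact: smooth_lift_coframe.
apply: smooth_lift_block; try exact: smooth_lift_cst.
  exact: smooth_lift_Gmx.
exact: smooth_lift_Hmx.
Qed.

Lemma smooth_lift_lift_J : smooth_lift (lift_J g A v i).
Proof.
apply: smooth_liftM; last exact: smooth_lift_frame.
apply: smooth_liftM; first exact: smooth_lift_coframe.
apply: smooth_lift_block; try exact: smooth_lift_cst.
  exact: smooth_lift_Gmx.
exact/smooth_liftN/smooth_lift_Hmx.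
Qed.

End LiftSmoothness.

Theorem theorem1 (R : realType) (n : nat) (M : atlas R n) (g : mx_comp M)
    (A : R) (v : R -> R)
    (hM : smooth_manifold M) (hg : riemannian_metric g)
    (hA : 0 < A) (hv : smooth_on_pos v)
    (hAv : forall t : R, 0 < t -> 0 < A + 2 * v t) :
  almost_kahler_manifold (lift_metric g A v) (lift_J g A v).
Proof.
have hCM := cotangent0_smooth_manifold hM.
have Ssym (i : chart M) z : dom i (base z) -> (Gamma0 g i z)^T = Gamma0 g i z.
  exact: Gamma0_sym.
have Gsym (i : chart M) z : dom i (base z) -> (Gmx g A v i z)^T = Gmx g A v i z.
  exact: Gmx_sym.
have Gpos (i : chart M) z : dom i (base z) -> posdef (Gmx g A v i z).
  exact: Gmx_posdef.
have uG (i : chart M) z : dom i (base z) -> Gmx g A v i z \in unitmx.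
  exact: Gmx_unit.
have phiE (i : chart M) z : dom i (base z) ->
    fundamental_form (lift_metric g A v) (lift_J g A v) i z =
    block_mx 0 (- 1%:M) 1%:M 0.
  move=> iz; rewrite /fundamental_form /lift_metric /lift_J /lift_metric_at /lift_J_at.
  rewrite !trmx_mul !mulmxA -(mulmxA _ (coframe g i z)^T) -trmx_mul.
  rewrite frame_coframe ?Ssym // trmx1 mulmx1.
  by rewrite -(mulmxA (coframe g i z)) diag_quarter ?Gsym ?uG // coframe_omega ?Ssym.
split=> //; split.
- split; first split.
  + move=> i a b; apply: (smooth_lift_in hM (i := i)).
    exact: smooth_lift_lift_metric.
  + move=> i j z iz jz; exact: (lift_metric_transition hM hg hA hAv (i := i) (j := j)).
  + move=> i z iz; rewrite /lift_metric /lift_metric_at !trmx_mul trmxK !mulmxA.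
    by rewrite tr_block_mx !trmx0 Gsym // trmx_inv Gsym.
  + move=> i z iz X X0; apply: posdef_conj => //.
      by have [] := mulmx1_unit (coframe_frame (Ssym i z iz)).
    by apply: posdef_block; [exact: Gpos|apply: posdef_inv; [exact: Gsym|exact: Gpos]].
- split; first split.
  + move=> i a b; apply: (smooth_lift_in hM (i := i)); exact: smooth_lift_lift_J.
  + move=> i j z iz jz; exact: (lift_J_transition hM hg hA hAv (i := i) (j := j)).
  + move=> i z iz; rewrite /lift_J /lift_J_at !mulmxA -(mulmxA _ (frame g i z)).
    rewrite frame_coframe ?Ssym // mulmx1 -(mulmxA (coframe g i z)) quarter_square ?uG //.
    by rewrite mulmxN mulmx1 mulNmx coframe_frame ?Ssym.
(* Compatibility is the matrix identity that conjugating the metric by the almost complex structure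
   returns the metric. The inner frames cancel and [quarter_conj] settles it in the adapted
   frame. *)
- move=> X Y _ _ i z iz; rewrite -beval_conj; congr ((_ *m _ *m _) 0 0).
  rewrite /lift_metric /lift_J /lift_metric_at /lift_J_at !trmx_mul !mulmxA.
  rewrite -(mulmxA _ (coframe g i z)^T) -trmx_mul frame_coframe ?Ssym // trmx1 mulmx1.
  rewrite -(mulmxA _ (frame g i z)) frame_coframe ?Ssym // mulmx1.
  by rewrite -!(mulmxA (coframe g i z)) quarter_conj ?Gsym ?uG // !mulmxA.
- split; first split; first split.
  + move=> i a b; apply: (smooth_lift_in hM (i := i)).
    exists (fun=> block_mx 0 (- 1%:M) 1%:M 0); first exact: smooth_mx_cst.
    by move=> z iz; rewrite phiE.
  (* The law of the fundamental form combines those of its two factors: the Jacobian to the right of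
     the metric is moved across the almost complex structure. *)
  + move=> i j z iz jz; rewrite /fundamental_form.
    rewrite (lift_metric_transition hM hg hA hAv (i := i) (j := j)) // -!mulmxA.
    congr (_ *m (_ *m _)).
    by rewrite -trmx_mul (lift_J_transition hM hg hA hAv (i := i) (j := j)) // trmx_mul.
  + move=> i z iz; rewrite phiE // tr_block_mx !trmx0 linearN /= !trmx1.
    by rewrite opp_block_mx !oppr0 opprK.
  + move=> i z iz a b c; rewrite /ext_deriv.
    (* The components are constant only at points of the chart, so the constant is substituted under
       the derivative by local equality. *)
    have E a' b' c' : partial_at (N := cotangent0_atlas M) i a' (fun y =>
        fundamental_form (lift_metric g A v) (lift_J g A v) i y b' c') z = 0.
      transitivity (partial_at (N := cotangent0_atlas M) i a'
        (fun=> (block_mx 0 (- 1%:M) 1%:M 0 : 'M[R]_(n + n)) b' c') z).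
        by apply: (@partial_at_eq _ _ _ hCM i i) => // y iy _; rewrite phiE.
      exact: partial_at_cst.
    by rewrite !E !addr0.
Qed.
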